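(* Let $L:\mathcal{C}_1\to\mathcal{C}_2$ be a 1-cell (lax double functor) in the bicategory $\mathsf{DoubleCat}$ of univalent double categories. Then $L$ is an adjoint equivalence in $\mathsf{DoubleCat}$ if and only if $L$ is a strong double functor and (the underlying 1-cell of) $L$ is an adjoint equivalence in the bicategory $\mathsf{TwoSidedDisp}$.
   Context: We work in univalent foundations: Martin-Löf type theory with the univalence axiom. Categories have hom-sets; a category is univalent if the canonical map from $x=y$ to isomorphisms $x\cong y$ is an equivalence of types for all $x,y$. Composition is in diagrammatic order. $a=_*b$ denotes equality in a type family over a canonical equality in the base (equality after transport). A 1-cell in a bicategory is an adjoint equivalence if it has a right adjoint whose unit and counit are invertible 2-cells. 2-sided displayed categories. A 2-sided displayed category $D$ over categories $C_1,C_2$ consists of: for $x_1:C_1$, $x_2:C_2$ a type $D_{(x_1,x_2)}$ of displayed objects; for $\bar x:D_{(x_1,x_2)}$, $\bar y:D_{(y_1,y_2)}$, $f_1:x_1\to y_1$, $f_2:x_2\to y_2$ a set $\bar x\to_{(f_1,f_2)}\bar y$ of displayed morphisms; displayed identities $\overline{\mathsf{id}}_{\bar x}:\bar x\to_{(\mathsf{id},\mathsf{id})}\bar x$; and compositions $\bar f\cdot\bar g:\bar x\to_{(f_1\cdot g_1,f_2\cdot g_2)}\bar z$; unital and associative up to $=_*$. A displayed morphism $\bar f$ over isomorphisms $f_1,f_2$ is an isomorphism if there is $\bar g:\bar y\to_{(f_1^{-1},f_2^{-1})}\bar x$ with $\bar f\cdot\bar g=_*\overline{\mathsf{id}}_{\bar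 x}$ and $\bar g\cdot\bar f=_*\overline{\mathsf{id}}_{\bar y}$. $D$ is univalent if for all $\bar x,\bar y:D_{(x_1,x_2)}$ the canonical map from $\bar x=\bar y$ to isomorphisms $\bar x\to_{(\mathsf{id},\mathsf{id})}\bar y$ is an equivalence of types. A 2-sided displayed functor $\bar F$ from $D$ (over $C,C$) to $D'$ (over $C',C'$) over $F:C\to C'$ on both sides sends $\bar x:D_{(x_1,x_2)}$ to $\bar F(\bar x):D'_{(Fx_1,Fx_2)}$ and $\bar f:\bar x\to_{(f_1,f_2)}\bar y$ to $\bar F(\bar f):\bar F(\bar x)\to_{(Ff_1,Ff_2)}\bar F(\bar y)$, preserving identities and composition up to $=_*$. A 2-sided displayed natural transformation $\bar\tau:\bar F\Rightarrow\bar G$ over $\tau:F\Rightarrow G$ on both sides assigns to each $\bar x:D_{(x_1,x_2)}$ a morphism $\bar\tau(\bar x):\bar F(\bar x)\to_{(\tau_{x_1},\tau_{x_2})}\bar G(\bar x)$ with $\bar F(\bar f)\cdot\bar\tau(\bar y)=_*\bar\tau(\bar x)\cdot\bar G(\bar f)$. The bicategory $\mathsf{TwoSidedDisp}$: objects are pairs $(C,D)$ of a univalent category $C$ and a univalent 2-sided displayed category $D$ over $C$ and $C$; 1-cells are pairs $(F,\bar F)$ of a functor and a 2-sided displayed functor over $F,F$; 2-cells are pairs $(\tau,\bar\tau)$ of a natural transformation and a 2-sided displayed natural transformation over $\tau,\tau$; with the evident operations. The bicategory $\mathsf{DoubleCat}$. Objects (univalent double categories): an object $(C,D)$ of $\mathsf{TwoSidedDisp}$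 with: horizontal identities, i.e. $\mathsf{id}_h(x):D_{(x,x)}$ and $\mathsf{id}_{sq}(v):\mathsf{id}_h(x)\to_{(v,v)}\mathsf{id}_h(y)$ for $v:x\to y$, functorial in $v$; horizontal composition, i.e. $h\odot k:D_{(x,z)}$ for $h:D_{(x,y)}$, $k:D_{(y,z)}$, and $s_1\odot s_2:h_1\odot k_1\to_{(v_1,v_3)}h_2\odot k_2$ for $s_1:h_1\to_{(v_1,v_2)}h_2$, $s_2:k_1\to_{(v_2,v_3)}k_2$, with $\overline{\mathsf{id}}_h\odot\overline{\mathsf{id}}_k=\overline{\mathsf{id}}_{h\odot k}$ and $(s_1\cdot t_1)\odot(s_2\cdot t_2)=(s_1\odot s_2)\cdot(t_1\odot t_2)$; displayed isomorphisms over identities $\lambda_h:\mathsf{id}_h(x)\odot h\to h$, $\rho_h:h\odot\mathsf{id}_h(y)\to h$, $\alpha_{h_1,h_2,h_3}:h_1\odot(h_2\odot h_3)\to(h_1\odot h_2)\odot h_3$, natural: $(\mathsf{id}_{sq}(v)\odot s)\cdot\lambda_k=_*\lambda_h\cdot s$, $(s\odot\mathsf{id}_{sq}(w))\cdot\rho_k=_*\rho_h\cdot s$ for $s:h\to_{(v,w)}k$, and $(s_1\odot(s_2\odot s_3))\cdot\alpha=_*\alpha\cdot((s_1\odot s_2)\odot s_3)$; satisfying the triangle law $\overline{\mathsf{id}}_h\odot\lambda_k=_*\alpha_{h,\mathsf{id}_h(y),k}\cdot(\rho_h\odot\overline{\mathsf{id}}_k)$ and the pentagon law $\alpha_{h_1,h_2,h_3\odot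 h_4}\cdot\alpha_{h_1\odot h_2,h_3,h_4}=_*(\overline{\mathsf{id}}_{h_1}\odot\alpha_{h_2,h_3,h_4})\cdot\alpha_{h_1,h_2\odot h_3,h_4}\cdot(\alpha_{h_1,h_2,h_3}\odot\overline{\mathsf{id}}_{h_4})$. 1-cells (lax double functors): a 1-cell $(F,\bar F)$ of $\mathsf{TwoSidedDisp}$ (with $\bar F$ also written $F$) with squares $F_{\mathsf{id}}(x):\mathsf{id}_h(Fx)\to_{(\mathsf{id},\mathsf{id})}F(\mathsf{id}_h(x))$ and $F_{\mathsf{comp}}(h,k):F(h)\odot F(k)\to_{(\mathsf{id},\mathsf{id})}F(h\odot k)$, natural: $\mathsf{id}_{sq}(Fv)\cdot F_{\mathsf{id}}(y)=_*F_{\mathsf{id}}(x)\cdot F(\mathsf{id}_{sq}(v))$ and $(F(s_1)\odot F(s_2))\cdot F_{\mathsf{comp}}(h_2,k_2)=_*F_{\mathsf{comp}}(h_1,k_1)\cdot F(s_1\odot s_2)$; such that $\lambda_{F(h)}=_*(F_{\mathsf{id}}(x)\odot\overline{\mathsf{id}})\cdot F_{\mathsf{comp}}(\mathsf{id}_h(x),h)\cdot F(\lambda_h)$, $\rho_{F(h)}=_*(\overline{\mathsf{id}}\odot F_{\mathsf{id}}(y))\cdot F_{\mathsf{comp}}(h,\mathsf{id}_h(y))\cdot F(\rho_h)$, and $\alpha_{Fh_1,Fh_2,Fh_3}\cdot(F_{\mathsf{comp}}(h_1,h_2)\odot\overline{\mathsf{id}})\cdot F_{\mathsf{comp}}(h_1\odot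 h_2,h_3)=_*(\overline{\mathsf{id}}\odot F_{\mathsf{comp}}(h_2,h_3))\cdot F_{\mathsf{comp}}(h_1,h_2\odot h_3)\cdot F(\alpha_{h_1,h_2,h_3})$. 2-cells from $F$ to $G$: a 2-cell $(\tau,\bar\tau)$ of $\mathsf{TwoSidedDisp}$ with $F_{\mathsf{id}}(x)\cdot\bar\tau(\mathsf{id}_h(x))=_*\mathsf{id}_{sq}(\tau_x)\cdot G_{\mathsf{id}}(x)$ and $F_{\mathsf{comp}}(h,k)\cdot\bar\tau(h\odot k)=_*(\bar\tau(h)\odot\bar\tau(k))\cdot G_{\mathsf{comp}}(h,k)$. All bicategory operations are the evident ones (the composite of $F$ followed by $G$ has comparisons $G_{\mathsf{id}}(Fx)\cdot G(F_{\mathsf{id}}(x))$ and $G_{\mathsf{comp}}(Fh,Fk)\cdot G(F_{\mathsf{comp}}(h,k))$). A lax double functor $F$ is a strong double functor if all squares $F_{\mathsf{id}}(x)$ and $F_{\mathsf{comp}}(h,k)$ are isomorphisms (as displayed morphisms over identities). *)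

(* Defs.v *)
From Stdlib Require Import FunctionalExtensionality.

Set Implicit Arguments.
Unset Strict Implicit.
Unset Printing Implicit Defensive.

(* Univalence of the universe is not assumed: the only axiom used below is
   function extensionality, so identity types keep their content (in particular
   univalent categories are not forced to be skeletal). *)

Definition is_hprop (A : Type) : Prop := forall x y : A, x = y.

Definition is_hset (A : Type) : Prop := forall x y : A, is_hprop (x = y).

Definition is_contr (A : Type) : Prop := exists c : A, forall x : A, x = c.

Definition is_equiv (A B : Type) (f : A -> B) : Prop :=
  forall b : B, is_contr {a : A & f a = b}.

Definition transport2 (A B : Type) (P : A -> B -> Type) (a a' : A) (b b' : B)
    (p : a = a') (q : b = b') : P a b -> P a' b' :=
  match p, q with eq_refl, eq_refl => fun u => u end.

Lemma is_hprop_forall (A : Type) (P : A -> Prop) :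
  (forall a, is_hprop (P a)) -> is_hprop (forall a, P a).
Proof.
  intros H f g. apply functional_extensionality_dep. intro a. apply H.
Qed.

Lemma is_hprop_and (P Q : Prop) :
  is_hprop P -> is_hprop Q -> is_hprop (P /\ Q).
Proof.
  intros hP hQ [p q] [p' q']. now rewrite (hP p p'), (hQ q q').
Qed.

(* A type whose equality is implied by a reflexive propositional relation is a
   set. *)
Lemma is_hset_of_rel (A : Type) (R : A -> A -> Prop) :
  (forall x y, is_hprop (R x y)) -> (forall x, R x x) ->
  (forall x y, R x y -> x = y) -> is_hset A.
Proof.
  intros hR rR eR x y p q.
  pose (r := fun z (e : x = z) =>
    match e in _ = z' return R x z' with eq_refl => rR x end).
  assert (K : forall z (e : x = z),
            e = eq_trans (eq_sym (eR x x (rR x))) (eR x z (r z e))).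
  { intros z e. destruct e. simpl. now destruct (eR x x (rR x)). }
  rewrite (K y p), (K y q). now rewrite (hR x y (r y p) (r y q)).
Qed.

Record category : Type := {
  ob :> Type;
  hom : ob -> ob -> Type;
  idm : forall x, hom x x;
  comp : forall x y z, hom x y -> hom y z -> hom x z;
  id_left : forall x y (f : hom x y), comp (idm x) f = f;
  id_right : forall x y (f : hom x y), comp f (idm y) = f;
  assoc : forall w x y z (f : hom w x) (g : hom x y) (h : hom y z),
    comp f (comp g h) = comp (comp f g) h;
  hom_set : forall x y, is_hset (hom x y)
}.

Arguments hom {c} x y.
Arguments idm {c} x.
Arguments comp {c x y z} _ _.
Arguments id_left {c x y} f : rename.
Arguments id_right {c x y} f : rename.
Arguments assoc {c w x y z} f g h : rename.
Arguments hom_set {c x y} f g p q : rename.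

Notation "x --> y" := (hom x y) (at level 55, no associativity).
Notation "f · g" := (comp f g) (at level 40, left associativity).

Record iso (C : category) (x y : C) : Type := {
  iso_mor :> x --> y;
  iso_inv : y --> x;
  iso_mor_inv : iso_mor · iso_inv = idm x;
  iso_inv_mor : iso_inv · iso_mor = idm y
}.

Definition id_iso (C : category) (x : C) : iso x x :=
  {| iso_mor := idm x; iso_inv := idm x;
     iso_mor_inv := id_left (idm x); iso_inv_mor := id_left (idm x) |}.

Definition idtoiso (C : category) (x y : C) (p : x = y) : iso x y :=
  match p with eq_refl => id_iso x end.

Definition is_univalent (C : category) : Prop :=
  forall x y : C, is_equiv (@idtoiso C x y).

Record functor (C C' : category) : Type := {
  fob :> C -> C';
  fmor : forall x y, x --> y -> fob x --> fob y;
  fmor_id : forall x, fmor (idm x) = idm (fob x);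
  fmor_comp : forall x y z (f : x --> y) (g : y --> z),
    fmor (f · g) = fmor f · fmor g
}.

Arguments fmor {C C'} F {x y} f : rename.
Arguments fmor_id {C C'} F x : rename.
Arguments fmor_comp {C C'} F {x y z} f g : rename.

Record nat_trans (C C' : category) (F G : functor C C') : Type := {
  ntr :> forall x, F x --> G x;
  ntr_natural : forall x y (f : x --> y), fmor F f · ntr y = ntr x · fmor G f
}.

Arguments ntr_natural {C C' F G} n {x y} f.

Record twosided_data (C1 C2 : category) : Type := {
  dob :> C1 -> C2 -> Type;
  dmor : forall (x1 y1 : C1) (x2 y2 : C2),
    x1 --> y1 -> x2 --> y2 -> dob x1 x2 -> dob y1 y2 -> Type;
  did : forall x1 x2 (xx : dob x1 x2), dmor (idm x1) (idm x2) xx xx;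
  dcomp : forall x1 y1 z1 x2 y2 z2
    (f1 : x1 --> y1) (f2 : x2 --> y2) (g1 : y1 --> z1) (g2 : y2 --> z2)
    (xx : dob x1 x2) (yy : dob y1 y2) (zz : dob z1 z2),
    dmor f1 f2 xx yy -> dmor g1 g2 yy zz -> dmor (f1 · g1) (f2 · g2) xx zz
}.

Arguments dmor {C1 C2 t x1 y1 x2 y2} f1 f2 xx yy.
Arguments did {C1 C2 t x1 x2} xx.
Arguments dcomp {C1 C2 t x1 y1 z1 x2 y2 z2 f1 f2 g1 g2 xx yy zz} _ _.

Notation "u ;; v" := (dcomp u v) (at level 45, left associativity).

(* Equality after transport.  Hom-types are sets, so the choice of the
   equalities [p] and [q] in the base is immaterial. *)
Definition deq (C1 C2 : category) (D : twosided_data C1 C2) (x1 y1 : C1)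
    (x2 y2 : C2) (xx : D x1 x2) (yy : D y1 y2)
    (f1 g1 : x1 --> y1) (f2 g2 : x2 --> y2)
    (u : dmor f1 f2 xx yy) (v : dmor g1 g2 xx yy) : Prop :=
  exists (p : f1 = g1) (q : f2 = g2),
    transport2 (P := fun h1 h2 => dmor h1 h2 xx yy) p q u = v.

Notation "u =* v" := (deq u v) (at level 70, no associativity).

Record twosided (C1 C2 : category) : Type := {
  ts_data :> twosided_data C1 C2;
  did_left : forall x1 y1 x2 y2 (f1 : x1 --> y1) (f2 : x2 --> y2)
    (xx : ts_data x1 x2) (yy : ts_data y1 y2) (u : dmor f1 f2 xx yy),
    did xx ;; u =* u;
  did_right : forall x1 y1 x2 y2 (f1 : x1 --> y1) (f2 : x2 --> y2)
    (xx : ts_data x1 x2) (yy : ts_data y1 y2) (u : dmor f1 f2 xx yy),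
    u ;; did yy =* u;
  dassoc : forall w1 x1 y1 z1 w2 x2 y2 z2
    (f1 : w1 --> x1) (g1 : x1 --> y1) (h1 : y1 --> z1)
    (f2 : w2 --> x2) (g2 : x2 --> y2) (h2 : y2 --> z2)
    (ww : ts_data w1 w2) (xx : ts_data x1 x2)
    (yy : ts_data y1 y2) (zz : ts_data z1 z2)
    (u : dmor f1 f2 ww xx) (v : dmor g1 g2 xx yy) (w : dmor h1 h2 yy zz),
    u ;; (v ;; w) =* u ;; v ;; w;
  dmor_set : forall x1 y1 x2 y2 (f1 : x1 --> y1) (f2 : x2 --> y2)
    (xx : ts_data x1 x2) (yy : ts_data y1 y2), is_hset (dmor f1 f2 xx yy)
}.

Arguments dmor_set {C1 C2} t {x1 y1 x2 y2 f1 f2 xx yy} _ _ _ _.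

Definition is_disp_iso (C1 C2 : category) (D : twosided C1 C2)
    (x1 y1 : C1) (x2 y2 : C2) (f1 : iso x1 y1) (f2 : iso x2 y2)
    (xx : D x1 x2) (yy : D y1 y2) (u : dmor f1 f2 xx yy) : Prop :=
  exists v : dmor (iso_inv f1) (iso_inv f2) yy xx,
    u ;; v =* did xx /\ v ;; u =* did yy.

Definition is_globular_iso (C1 C2 : category) (D : twosided C1 C2)
    (x1 : C1) (x2 : C2) (xx yy : D x1 x2)
    (u : dmor (idm x1) (idm x2) xx yy) : Prop :=
  is_disp_iso (f1 := id_iso x1) (f2 := id_iso x2) u.

Record globular_iso (C1 C2 : category) (D : twosided C1 C2)
    (x1 : C1) (x2 : C2) (xx yy : D x1 x2) : Type := {
  giso_mor :> dmor (idm x1) (idm x2) xx yy;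
  giso_is_iso : is_globular_iso giso_mor
}.

Lemma did_is_iso (C1 C2 : category) (D : twosided C1 C2) (x1 : C1) (x2 : C2)
    (xx : D x1 x2) : is_globular_iso (did xx).
Proof. exists (did xx). split; apply did_left. Qed.

Definition did_iso (C1 C2 : category) (D : twosided C1 C2) (x1 : C1) (x2 : C2)
    (xx : D x1 x2) : globular_iso xx xx :=
  {| giso_mor := did xx; giso_is_iso := did_is_iso xx |}.

Definition disp_idtoiso (C1 C2 : category) (D : twosided C1 C2)
    (x1 : C1) (x2 : C2) (xx yy : D x1 x2) (p : xx = yy) : globular_iso xx yy :=
  match p with eq_refl => did_iso xx end.

Definition is_disp_univalent (C1 C2 : category) (D : twosided C1 C2) : Prop :=
  forall (x1 : C1) (x2 : C2) (xx yy : D x1 x2),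
    is_equiv (@disp_idtoiso C1 C2 D x1 x2 xx yy).

Section DeqCalculus.
Variables (C1 C2 : category).

Section Data.
Variable (D : twosided_data C1 C2).

Lemma deq_refl x1 y1 x2 y2 (xx : D x1 x2) (yy : D y1 y2)
    (f1 : x1 --> y1) (f2 : x2 --> y2) (u : dmor f1 f2 xx yy) : u =* u.
Proof. now exists eq_refl, eq_refl. Qed.

Lemma deq_sym x1 y1 x2 y2 (xx : D x1 x2) (yy : D y1 y2)
    (f1 g1 : x1 --> y1) (f2 g2 : x2 --> y2)
    (u : dmor f1 f2 xx yy) (v : dmor g1 g2 xx yy) : u =* v -> v =* u.
Proof. intros [p [q e]]. destruct p, q, e. apply deq_refl. Qed.

Lemma deq_trans x1 y1 x2 y2 (xx : D x1 x2) (yy : D y1 y2)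
    (f1 g1 h1 : x1 --> y1) (f2 g2 h2 : x2 --> y2)
    (u : dmor f1 f2 xx yy) (v : dmor g1 g2 xx yy) (w : dmor h1 h2 xx yy) :
  u =* v -> v =* w -> u =* w.
Proof. intros [p [q e]]. now destruct p, q, e. Qed.

Lemma deq_of_eq x1 y1 x2 y2 (xx : D x1 x2) (yy : D y1 y2)
    (f1 : x1 --> y1) (f2 : x2 --> y2) (u v : dmor f1 f2 xx yy) :
  u = v -> u =* v.
Proof. intros e. destruct e. apply deq_refl. Qed.

Lemma eq_of_deq x1 y1 x2 y2 (xx : D x1 x2) (yy : D y1 y2)
    (f1 : x1 --> y1) (f2 : x2 --> y2) (u v : dmor f1 f2 xx yy) :
  u =* v -> u = v.
Proof.
  intros [p [q e]].
  now rewrite (hom_set _ _ p eq_refl), (hom_set _ _ q eq_refl) in e.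
Qed.

Lemma deq_comp x1 y1 z1 x2 y2 z2
    (f1 f1' : x1 --> y1) (f2 f2' : x2 --> y2)
    (g1 g1' : y1 --> z1) (g2 g2' : y2 --> z2)
    (xx : D x1 x2) (yy : D y1 y2) (zz : D z1 z2)
    (u : dmor f1 f2 xx yy) (u' : dmor f1' f2' xx yy)
    (v : dmor g1 g2 yy zz) (v' : dmor g1' g2' yy zz) :
  u =* u' -> v =* v' -> u ;; v =* u' ;; v'.
Proof.
  intros [p [q e]] [p' [q' e']]. destruct p, q, e, p', q', e'. apply deq_refl.
Qed.

Definition dcast x1 y1 x2 y2 (xx : D x1 x2) (yy : D y1 y2)
    (f1 g1 : x1 --> y1) (f2 g2 : x2 --> y2) (p : f1 = g1) (q : f2 = g2)
    (u : dmor f1 f2 xx yy) : dmor g1 g2 xx yy :=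
  transport2 (P := fun h1 h2 => dmor h1 h2 xx yy) p q u.

Lemma deq_cast x1 y1 x2 y2 (xx : D x1 x2) (yy : D y1 y2)
    (f1 g1 : x1 --> y1) (f2 g2 : x2 --> y2) (p : f1 = g1) (q : f2 = g2)
    (u : dmor f1 f2 xx yy) : dcast p q u =* u.
Proof. destruct p, q. apply deq_refl. Qed.

End Data.

Lemma is_hprop_deq (D : twosided C1 C2) x1 y1 x2 y2
    (xx : D x1 x2) (yy : D y1 y2)
    (f1 g1 : x1 --> y1) (f2 g2 : x2 --> y2)
    (u : dmor f1 f2 xx yy) (v : dmor g1 g2 xx yy) : is_hprop (u =* v).
Proof.
  intros [p [q e]] [p' [q' e']].
  destruct (hom_set _ _ p p'), (hom_set _ _ q q').
  now destruct (dmor_set D _ _ e e').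
Qed.

End DeqCalculus.

(* Total squares: [u =* v] amounts to equality of total squares, which satisfy
   the laws of a category strictly. *)
Section TotalSquares.
Variables (C1 C2 : category) (D : twosided C1 C2).

Definition tot_hom x1 y1 x2 y2 (xx : D x1 x2) (yy : D y1 y2) : Type :=
  {f : (x1 --> y1) * (x2 --> y2) & dmor (fst f) (snd f) xx yy}.

Definition tot x1 y1 x2 y2 (xx : D x1 x2) (yy : D y1 y2)
    (f1 : x1 --> y1) (f2 : x2 --> y2) (u : dmor f1 f2 xx yy) : tot_hom xx yy :=
  existT (fun f => dmor (fst f) (snd f) xx yy) (f1, f2) u.

Definition tot_id x1 x2 (xx : D x1 x2) : tot_hom xx xx := tot (did xx).

Definition tot_comp x1 y1 z1 x2 y2 z2 (xx : D x1 x2) (yy : D y1 y2)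
    (zz : D z1 z2) (s : tot_hom xx yy) (t : tot_hom yy zz) : tot_hom xx zz :=
  tot (projT2 s ;; projT2 t).

Lemma tot_eq x1 y1 x2 y2 (xx : D x1 x2) (yy : D y1 y2)
    (f1 g1 : x1 --> y1) (f2 g2 : x2 --> y2)
    (u : dmor f1 f2 xx yy) (v : dmor g1 g2 xx yy) : u =* v -> tot u = tot v.
Proof. intros [p [q e]]. now destruct p, q, e. Qed.

Lemma deq_tot x1 y1 x2 y2 (xx : D x1 x2) (yy : D y1 y2)
    (f1 g1 : x1 --> y1) (f2 g2 : x2 --> y2)
    (u : dmor f1 f2 xx yy) (v : dmor g1 g2 xx yy) : tot u = tot v -> u =* v.
Proof.
  intros e. change (projT2 (tot u) =* projT2 (tot v)).
  rewrite e. apply deq_refl.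
Qed.

Lemma tot_dcomp x1 y1 z1 x2 y2 z2
    (f1 : x1 --> y1) (f2 : x2 --> y2) (g1 : y1 --> z1) (g2 : y2 --> z2)
    (xx : D x1 x2) (yy : D y1 y2) (zz : D z1 z2)
    (u : dmor f1 f2 xx yy) (v : dmor g1 g2 yy zz) :
  tot (u ;; v) = tot_comp (tot u) (tot v).
Proof. reflexivity. Qed.

Lemma tot_did x1 x2 (xx : D x1 x2) : tot (did xx) = tot_id xx.
Proof. reflexivity. Qed.

Lemma tot_dcast x1 y1 x2 y2 (xx : D x1 x2) (yy : D y1 y2)
    (f1 g1 : x1 --> y1) (f2 g2 : x2 --> y2) (p : f1 = g1) (q : f2 = g2)
    (u : dmor f1 f2 xx yy) : tot (dcast p q u) = tot u.
Proof. now destruct p, q. Qed.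

Lemma tot_id_left x1 y1 x2 y2 (xx : D x1 x2) (yy : D y1 y2)
    (s : tot_hom xx yy) : tot_comp (tot_id xx) s = s.
Proof. destruct s as [[f1 f2] u]. apply (tot_eq (did_left u)). Qed.

Lemma tot_id_right x1 y1 x2 y2 (xx : D x1 x2) (yy : D y1 y2)
    (s : tot_hom xx yy) : tot_comp s (tot_id yy) = s.
Proof. destruct s as [[f1 f2] u]. apply (tot_eq (did_right u)). Qed.

Lemma tot_assoc w1 x1 y1 z1 w2 x2 y2 z2 (ww : D w1 w2) (xx : D x1 x2)
    (yy : D y1 y2) (zz : D z1 z2)
    (s : tot_hom ww xx) (t : tot_hom xx yy) (r : tot_hom yy zz) :
  tot_comp s (tot_comp t r) = tot_comp (tot_comp s t) r.
Proof.
  destruct s as [[f1 f2] u], t as [[g1 g2] v], r as [[h1 h2] w].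
  apply (tot_eq (dassoc u v w)).
Qed.

End TotalSquares.

Record disp_functor (C1 C2 C1' C2' : category)
    (F1 : functor C1 C1') (F2 : functor C2 C2')
    (D : twosided C1 C2) (D' : twosided C1' C2') : Type := {
  dfob : forall x1 x2, D x1 x2 -> D' (F1 x1) (F2 x2);
  dfmor : forall x1 y1 x2 y2 (f1 : x1 --> y1) (f2 : x2 --> y2)
    (xx : D x1 x2) (yy : D y1 y2),
    dmor f1 f2 xx yy -> dmor (fmor F1 f1) (fmor F2 f2) (dfob xx) (dfob yy);
  dfmor_id : forall x1 x2 (xx : D x1 x2), dfmor (did xx) =* did (dfob xx);
  dfmor_comp : forall x1 y1 z1 x2 y2 z2
    (f1 : x1 --> y1) (f2 : x2 --> y2) (g1 : y1 --> z1) (g2 : y2 --> z2)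
    (xx : D x1 x2) (yy : D y1 y2) (zz : D z1 z2)
    (u : dmor f1 f2 xx yy) (v : dmor g1 g2 yy zz),
    dfmor (u ;; v) =* dfmor u ;; dfmor v
}.

Arguments dfob {C1 C2 C1' C2' F1 F2 D D'} d {x1 x2} xx.
Arguments dfmor {C1 C2 C1' C2' F1 F2 D D'} d {x1 y1 x2 y2 f1 f2 xx yy} _.
Arguments dfmor_id {C1 C2 C1' C2' F1 F2 D D'} d {x1 x2} xx.
Arguments dfmor_comp {C1 C2 C1' C2' F1 F2 D D'} d
  {x1 y1 z1 x2 y2 z2 f1 f2 g1 g2 xx yy zz} _ _.

Record disp_nat_trans (C1 C2 C1' C2' : category)
    (F1 G1 : functor C1 C1') (F2 G2 : functor C2 C2')
    (D : twosided C1 C2) (D' : twosided C1' C2')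
    (tau1 : nat_trans F1 G1) (tau2 : nat_trans F2 G2)
    (FF : disp_functor F1 F2 D D') (GG : disp_functor G1 G2 D D') : Type := {
  dntr : forall x1 x2 (xx : D x1 x2),
    dmor (tau1 x1) (tau2 x2) (dfob FF xx) (dfob GG xx);
  dntr_natural : forall x1 y1 x2 y2 (f1 : x1 --> y1) (f2 : x2 --> y2)
    (xx : D x1 x2) (yy : D y1 y2) (u : dmor f1 f2 xx yy),
    dfmor FF u ;; dntr yy =* dntr xx ;; dfmor GG u
}.

Arguments dntr {C1 C2 C1' C2' F1 G1 F2 G2 D D' tau1 tau2 FF GG} d {x1 x2} xx.
Arguments dntr_natural {C1 C2 C1' C2' F1 G1 F2 G2 D D' tau1 tau2 FF GG} d
  {x1 y1 x2 y2 f1 f2 xx yy} u.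

Section TotalFunctor.
Variables (C1 C2 C1' C2' : category) (F1 : functor C1 C1') (F2 : functor C2 C2')
  (D : twosided C1 C2) (D' : twosided C1' C2') (FF : disp_functor F1 F2 D D').

Lemma deq_dfmor x1 y1 x2 y2 (xx : D x1 x2) (yy : D y1 y2)
    (f1 g1 : x1 --> y1) (f2 g2 : x2 --> y2)
    (u : dmor f1 f2 xx yy) (v : dmor g1 g2 xx yy) :
  u =* v -> dfmor FF u =* dfmor FF v.
Proof. intros [p [q e]]. destruct p, q, e. apply deq_refl. Qed.

Definition tot_fun x1 y1 x2 y2 (xx : D x1 x2) (yy : D y1 y2)
    (s : tot_hom xx yy) : tot_hom (dfob FF xx) (dfob FF yy) :=
  tot (dfmor FF (projT2 s)).

Lemma tot_dfmor x1 y1 x2 y2 (xx : D x1 x2) (yy : D y1 y2)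
    (f1 : x1 --> y1) (f2 : x2 --> y2) (u : dmor f1 f2 xx yy) :
  tot (dfmor FF u) = tot_fun (tot u).
Proof. reflexivity. Qed.

Lemma tot_fun_id x1 x2 (xx : D x1 x2) : tot_fun (tot_id xx) = tot_id _.
Proof. apply (tot_eq (dfmor_id FF xx)). Qed.

Lemma tot_fun_comp x1 y1 z1 x2 y2 z2 (xx : D x1 x2) (yy : D y1 y2)
    (zz : D z1 z2) (s : tot_hom xx yy) (t : tot_hom yy zz) :
  tot_fun (tot_comp s t) = tot_comp (tot_fun s) (tot_fun t).
Proof.
  destruct s as [[f1 f2] u], t as [[g1 g2] v]. apply (tot_eq (dfmor_comp FF u v)).
Qed.

End TotalFunctor.

Lemma tot_dntr (C1 C2 C1' C2' : category)
    (F1 G1 : functor C1 C1') (F2 G2 : functor C2 C2')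
    (D : twosided C1 C2) (D' : twosided C1' C2')
    (tau1 : nat_trans F1 G1) (tau2 : nat_trans F2 G2)
    (FF : disp_functor F1 F2 D D') (GG : disp_functor G1 G2 D D')
    (tt : disp_nat_trans tau1 tau2 FF GG)
    x1 y1 x2 y2 (f1 : x1 --> y1) (f2 : x2 --> y2)
    (xx : D x1 x2) (yy : D y1 y2) (u : dmor f1 f2 xx yy) :
  tot_comp (tot_fun FF (tot u)) (tot (dntr tt yy))
  = tot_comp (tot (dntr tt xx)) (tot_fun GG (tot u)).
Proof. apply (tot_eq (dntr_natural tt u)). Qed.

Ltac cat_simp :=
  repeat first [ rewrite fmor_id | rewrite fmor_comp
               | rewrite id_left | rewrite id_right | rewrite assoc ].

Ltac tot_simp :=
  repeat first [ rewrite tot_dcast | rewrite tot_dcomp | rewrite tot_did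
               | rewrite tot_dfmor ];
  repeat first [ rewrite tot_fun_id | rewrite tot_fun_comp
               | rewrite tot_id_left | rewrite tot_id_right
               | rewrite tot_assoc ].

Definition functor_id (C : category) : functor C C :=
  {| fob := fun x => x; fmor := fun x y f => f;
     fmor_id := fun x => eq_refl; fmor_comp := fun x y z f g => eq_refl |}.

Lemma functor_comp_id (C C' C'' : category) (F : functor C C')
    (G : functor C' C'') (x : C) : fmor G (fmor F (idm x)) = idm (G (F x)).
Proof. now cat_simp. Qed.

Lemma functor_comp_comp (C C' C'' : category) (F : functor C C')
    (G : functor C' C'') (x y z : C) (f : x --> y) (g : y --> z) :
  fmor G (fmor F (f · g)) = fmor G (fmor F f) · fmor G (fmor F g).
Proof. now cat_simp. Qed.

Definition functor_comp (C C' C'' : category) (F : functor C C')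
    (G : functor C' C'') : functor C C'' :=
  {| fob := fun x => G (F x); fmor := fun x y f => fmor G (fmor F f);
     fmor_id := functor_comp_id F G; fmor_comp := functor_comp_comp F G |}.

Lemma nat_trans_comp_natural (C C' : category) (F G H : functor C C')
    (s : nat_trans F G) (t : nat_trans G H) (x y : C) (f : x --> y) :
  fmor F f · (s y · t y) = s x · t x · fmor H f.
Proof.
  rewrite assoc, ntr_natural, <- assoc, ntr_natural. apply assoc.
Qed.

Definition nat_trans_comp (C C' : category) (F G H : functor C C')
    (s : nat_trans F G) (t : nat_trans G H) : nat_trans F H :=
  {| ntr := fun x => s x · t x; ntr_natural := nat_trans_comp_natural s t |}.

Lemma nat_trans_rwhisker_natural (C C' C'' : category) (F G : functor C C')
    (t : nat_trans F G) (H : functor C' C'') (x y : C) (f : x --> y) :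
  fmor H (fmor F f) · fmor H (t y) = fmor H (t x) · fmor H (fmor G f).
Proof. now rewrite <- !fmor_comp, ntr_natural. Qed.

Section DispFunctorOps.
Variables (C1 C2 C1' C2' C1'' C2'' : category).
Variables (D : twosided C1 C2) (D' : twosided C1' C2') (D'' : twosided C1'' C2'').

Definition disp_functor_id : disp_functor (functor_id C1) (functor_id C2) D D :=
  @Build_disp_functor _ _ _ _ (functor_id C1) (functor_id C2) D D
    (fun x1 x2 xx => xx) (fun x1 y1 x2 y2 f1 f2 xx yy u => u)
    (fun x1 x2 xx => deq_refl _)
    (fun x1 y1 z1 x2 y2 z2 f1 f2 g1 g2 xx yy zz u v => deq_refl _).

Variables (F1 : functor C1 C1') (F2 : functor C2 C2').
Variables (G1 : functor C1' C1'') (G2 : functor C2' C2'').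
Variables (FF : disp_functor F1 F2 D D') (GG : disp_functor G1 G2 D' D'').

Lemma disp_functor_comp_id x1 x2 (xx : D x1 x2) :
  dfmor GG (dfmor FF (did xx)) =* did (dfob GG (dfob FF xx)).
Proof. apply deq_tot. now tot_simp. Qed.

Lemma disp_functor_comp_comp x1 y1 z1 x2 y2 z2
    (f1 : x1 --> y1) (f2 : x2 --> y2) (g1 : y1 --> z1) (g2 : y2 --> z2)
    (xx : D x1 x2) (yy : D y1 y2) (zz : D z1 z2)
    (u : dmor f1 f2 xx yy) (v : dmor g1 g2 yy zz) :
  dfmor GG (dfmor FF (u ;; v))
  =* dfmor GG (dfmor FF u) ;; dfmor GG (dfmor FF v).
Proof. apply deq_tot. now tot_simp. Qed.

Definition disp_functor_comp :
  disp_functor (functor_comp F1 G1) (functor_comp F2 G2) D D'' :=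
  @Build_disp_functor _ _ _ _ (functor_comp F1 G1) (functor_comp F2 G2) D D''
    (fun x1 x2 xx => dfob GG (dfob FF xx))
    (fun x1 y1 x2 y2 f1 f2 xx yy u => dfmor GG (dfmor FF u))
    (@disp_functor_comp_id)
    (@disp_functor_comp_comp).

End DispFunctorOps.

Record bicategory : Type := {
  cell0 :> Type;
  cell1 : cell0 -> cell0 -> Type;
  cell2 : forall x y, cell1 x y -> cell1 x y -> Type;
  id1 : forall x, cell1 x x;
  comp1 : forall x y z, cell1 x y -> cell1 y z -> cell1 x z;
  id2 : forall x y (f : cell1 x y), cell2 f f;
  vcomp : forall x y (f g h : cell1 x y), cell2 f g -> cell2 g h -> cell2 f h;
  lwhisker : forall x y z (f : cell1 x y) (g h : cell1 y z),
    cell2 g h -> cell2 (comp1 f g) (comp1 f h);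
  rwhisker : forall x y z (f g : cell1 x y) (h : cell1 y z),
    cell2 f g -> cell2 (comp1 f h) (comp1 g h);
  lunitor : forall x y (f : cell1 x y), cell2 (comp1 (id1 x) f) f;
  linvunitor : forall x y (f : cell1 x y), cell2 f (comp1 (id1 x) f);
  runitor : forall x y (f : cell1 x y), cell2 (comp1 f (id1 y)) f;
  rinvunitor : forall x y (f : cell1 x y), cell2 f (comp1 f (id1 y));
  lassociator : forall w x y z (f : cell1 w x) (g : cell1 x y) (h : cell1 y z),
    cell2 (comp1 f (comp1 g h)) (comp1 (comp1 f g) h);
  rassociator : forall w x y z (f : cell1 w x) (g : cell1 x y) (h : cell1 y z),
    cell2 (comp1 (comp1 f g) h) (comp1 f (comp1 g h));
  id2_left : forall x y (f g : cell1 x y) (a : cell2 f g), vcomp (id2 f) a = a;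
  id2_right : forall x y (f g : cell1 x y) (a : cell2 f g), vcomp a (id2 g) = a;
  vassoc : forall x y (f g h k : cell1 x y)
    (a : cell2 f g) (b : cell2 g h) (c : cell2 h k),
    vcomp a (vcomp b c) = vcomp (vcomp a b) c;
  lwhisker_id2 : forall x y z (f : cell1 x y) (g : cell1 y z),
    lwhisker f (id2 g) = id2 (comp1 f g);
  id2_rwhisker : forall x y z (f : cell1 x y) (g : cell1 y z),
    rwhisker g (id2 f) = id2 (comp1 f g);
  lwhisker_vcomp : forall x y z (f : cell1 x y) (g h k : cell1 y z)
    (a : cell2 g h) (b : cell2 h k),
    vcomp (lwhisker f a) (lwhisker f b) = lwhisker f (vcomp a b);
  rwhisker_vcomp : forall x y z (f g h : cell1 x y) (k : cell1 y z)
    (a : cell2 f g) (b : cell2 g h),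
    vcomp (rwhisker k a) (rwhisker k b) = rwhisker k (vcomp a b);
  vcomp_lunitor : forall x y (f g : cell1 x y) (a : cell2 f g),
    vcomp (lwhisker (id1 x) a) (lunitor g) = vcomp (lunitor f) a;
  vcomp_runitor : forall x y (f g : cell1 x y) (a : cell2 f g),
    vcomp (rwhisker (id1 y) a) (runitor g) = vcomp (runitor f) a;
  lwhisker_lwhisker : forall w x y z (f : cell1 w x) (g : cell1 x y)
    (h k : cell1 y z) (a : cell2 h k),
    vcomp (lwhisker f (lwhisker g a)) (lassociator f g k)
    = vcomp (lassociator f g h) (lwhisker (comp1 f g) a);
  rwhisker_lwhisker : forall w x y z (f : cell1 w x) (g h : cell1 x y)
    (k : cell1 y z) (a : cell2 g h),
    vcomp (lwhisker f (rwhisker k a)) (lassociator f h k)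
    = vcomp (lassociator f g k) (rwhisker k (lwhisker f a));
  rwhisker_rwhisker : forall w x y z (f g : cell1 w x) (h : cell1 x y)
    (k : cell1 y z) (a : cell2 f g),
    vcomp (lassociator f h k) (rwhisker k (rwhisker h a))
    = vcomp (rwhisker (comp1 h k) a) (lassociator g h k);
  vcomp_whisker : forall x y z (f g : cell1 x y) (h k : cell1 y z)
    (a : cell2 f g) (b : cell2 h k),
    vcomp (rwhisker h a) (lwhisker g b) = vcomp (lwhisker f b) (rwhisker k a);
  lunitor_linvunitor : forall x y (f : cell1 x y),
    vcomp (lunitor f) (linvunitor f) = id2 (comp1 (id1 x) f);
  linvunitor_lunitor : forall x y (f : cell1 x y),
    vcomp (linvunitor f) (lunitor f) = id2 f;
  runitor_rinvunitor : forall x y (f : cell1 x y),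
    vcomp (runitor f) (rinvunitor f) = id2 (comp1 f (id1 y));
  rinvunitor_runitor : forall x y (f : cell1 x y),
    vcomp (rinvunitor f) (runitor f) = id2 f;
  lassociator_rassociator : forall w x y z
    (f : cell1 w x) (g : cell1 x y) (h : cell1 y z),
    vcomp (lassociator f g h) (rassociator f g h) = id2 (comp1 f (comp1 g h));
  rassociator_lassociator : forall w x y z
    (f : cell1 w x) (g : cell1 x y) (h : cell1 y z),
    vcomp (rassociator f g h) (lassociator f g h) = id2 (comp1 (comp1 f g) h);
  runitor_rwhisker : forall x y z (f : cell1 x y) (g : cell1 y z),
    vcomp (lassociator f (id1 y) g) (rwhisker g (runitor f))
    = lwhisker f (lunitor g);
  lassociator_lassociator : forall v w x y z
    (f : cell1 v w) (g : cell1 w x) (h : cell1 x y) (k : cell1 y z),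
    vcomp (vcomp (lwhisker f (lassociator g h k)) (lassociator f (comp1 g h) k))
          (rwhisker k (lassociator f g h))
    = vcomp (lassociator f g (comp1 h k)) (lassociator (comp1 f g) h k);
  cell2_set : forall x y (f g : cell1 x y), is_hset (cell2 f g)
}.

Arguments cell1 {b} x y : rename.
Arguments cell2 {b x y} f g : rename.
Arguments id1 {b} x : rename.
Arguments comp1 {b x y z} _ _ : rename.
Arguments id2 {b x y} f : rename.
Arguments vcomp {b x y f g h} _ _ : rename.
Arguments lwhisker {b x y z} f {g h} _ : rename.
Arguments rwhisker {b x y z f g} h _ : rename.
Arguments lunitor {b x y} f : rename.
Arguments linvunitor {b x y} f : rename.
Arguments runitor {b x y} f : rename.
Arguments rinvunitor {b x y} f : rename.
Arguments lassociator {b w x y z} f g h : rename.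
Arguments rassociator {b w x y z} f g h : rename.

Notation "f ∗ g" := (comp1 f g) (at level 40, left associativity).
Notation "a • b" := (vcomp a b) (at level 45, left associativity).
Notation "f ◃ a" := (lwhisker f a) (at level 42, right associativity).
Notation "a ▹ h" := (rwhisker h a) (at level 43, left associativity).

Definition is_invertible_2cell (B : bicategory) (x y : B) (f g : cell1 x y)
    (a : cell2 f g) : Prop :=
  exists b : cell2 g f, a • b = id2 f /\ b • a = id2 g.

Record right_adjoint (B : bicategory) (x y : B) (l : cell1 x y) : Type := {
  radj : cell1 y x;
  adj_unit : cell2 (id1 x) (l ∗ radj);
  adj_counit : cell2 (radj ∗ l) (id1 y);
  adj_triangle_l :
    linvunitor l • (adj_unit ▹ l) • rassociator l radj l
      • (l ◃ adj_counit) • runitor l = id2 l;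
  adj_triangle_r :
    rinvunitor radj • (radj ◃ adj_unit) • lassociator radj l radj
      • (adj_counit ▹ radj) • lunitor radj = id2 radj
}.

Definition is_adjoint_equivalence (B : bicategory) (x y : B) (l : cell1 x y) :
    Prop :=
  exists r : right_adjoint l,
    is_invertible_2cell (adj_unit r) /\ is_invertible_2cell (adj_counit r).

Record tsd_ob : Type := {
  tsd_cat :> category;
  tsd_cat_univalent : is_univalent tsd_cat;
  tsd_disp : twosided tsd_cat tsd_cat;
  tsd_disp_univalent : is_disp_univalent tsd_disp
}.

Record tsd_mor (X Y : tsd_ob) : Type := {
  tsd_fun :> functor X Y;
  tsd_dfun : disp_functor tsd_fun tsd_fun (tsd_disp X) (tsd_disp Y)
}.

Arguments tsd_dfun {X Y} t.

Record tsd_cell (X Y : tsd_ob) (F G : tsd_mor X Y) : Type := {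
  tsd_nt :> nat_trans F G;
  tsd_dnt : disp_nat_trans tsd_nt tsd_nt (tsd_dfun F) (tsd_dfun G)
}.

Arguments tsd_dnt {X Y F G} t.

Definition tsd_cell_rel (X Y : tsd_ob) (F G : tsd_mor X Y)
    (s t : tsd_cell F G) : Prop :=
  (forall x : X, s x = t x) /\
  (forall (x y : X) (h : tsd_disp X x y),
     dntr (tsd_dnt s) h =* dntr (tsd_dnt t) h).

Lemma nat_trans_eq (C C' : category) (F G : functor C C') (s t : nat_trans F G) :
  (forall x, s x = t x) -> s = t.
Proof.
  destruct s as [s sn], t as [t tn]. simpl. intro H.
  assert (e : s = t) by now apply functional_extensionality_dep.
  destruct e. f_equal.
  repeat (apply is_hprop_forall; intro). apply hom_set.
Qed.

Lemma disp_nat_trans_eq (C1 C2 C1' C2' : category)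
    (F1 G1 : functor C1 C1') (F2 G2 : functor C2 C2')
    (D : twosided C1 C2) (D' : twosided C1' C2')
    (tau1 : nat_trans F1 G1) (tau2 : nat_trans F2 G2)
    (FF : disp_functor F1 F2 D D') (GG : disp_functor G1 G2 D D')
    (s t : disp_nat_trans tau1 tau2 FF GG) :
  (forall x1 x2 (xx : D x1 x2), dntr s xx = dntr t xx) -> s = t.
Proof.
  destruct s as [s sn], t as [t tn]. simpl. intro H.
  assert (e : s = t) by now repeat (apply functional_extensionality_dep; intro).
  destruct e. f_equal.
  repeat (apply is_hprop_forall; intro). apply is_hprop_deq.
Qed.

Lemma tsd_cell_eq (X Y : tsd_ob) (F G : tsd_mor X Y) (s t : tsd_cell F G) :
  tsd_cell_rel s t -> s = t.
Proof.
  destruct s as [s ss], t as [t tt]. intros [H HH]. simpl in *.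
  destruct (nat_trans_eq H). f_equal. apply disp_nat_trans_eq. intros.
  apply eq_of_deq, HH.
Qed.

Lemma tsd_cell_set (X Y : tsd_ob) (F G : tsd_mor X Y) : is_hset (tsd_cell F G).
Proof.
  apply is_hset_of_rel with (R := @tsd_cell_rel X Y F G).
  - intros s t. apply is_hprop_and; repeat (apply is_hprop_forall; intro).
    + apply hom_set.
    + apply is_hprop_deq.
  - intro s. split; intros; [reflexivity | apply deq_refl].
  - intros s t. apply tsd_cell_eq.
Qed.

Definition tsd_id1 (X : tsd_ob) : tsd_mor X X :=
  {| tsd_fun := functor_id X; tsd_dfun := disp_functor_id (tsd_disp X) |}.

Definition tsd_comp1 (X Y Z : tsd_ob) (F : tsd_mor X Y) (G : tsd_mor Y Z) :
    tsd_mor X Z :=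
  {| tsd_fun := functor_comp F G;
     tsd_dfun := disp_functor_comp (tsd_dfun F) (tsd_dfun G) |}.

Definition make_tsd_cell (X Y : tsd_ob) (F G : tsd_mor X Y)
    (t : forall x : X, F x --> G x)
    (tn : forall (x y : X) (f : x --> y), fmor F f · t y = t x · fmor G f)
    (tt : forall (x y : X) (h : tsd_disp X x y),
      dmor (t x) (t y) (dfob (tsd_dfun F) h) (dfob (tsd_dfun G) h))
    (ttn : forall (x1 y1 x2 y2 : X) (f1 : x1 --> y1) (f2 : x2 --> y2)
      (h : tsd_disp X x1 x2) (k : tsd_disp X y1 y2) (u : dmor f1 f2 h k),
      dfmor (tsd_dfun F) u ;; tt y1 y2 k =* tt x1 x2 h ;; dfmor (tsd_dfun G) u) :
    tsd_cell F G :=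
  let n := @Build_nat_trans _ _ F G t tn in
  {| tsd_nt := n;
     tsd_dnt := @Build_disp_nat_trans _ _ _ _ _ _ _ _ _ _ n n _ _ tt ttn |}.

Lemma tsd_vcomp_natural (X Y : tsd_ob) (F G H : tsd_mor X Y)
    (s : tsd_cell F G) (t : tsd_cell G H)
    (x1 y1 x2 y2 : X) (f1 : x1 --> y1) (f2 : x2 --> y2)
    (h : tsd_disp X x1 x2) (k : tsd_disp X y1 y2) (u : dmor f1 f2 h k) :
  dfmor (tsd_dfun F) u ;; (dntr (tsd_dnt s) k ;; dntr (tsd_dnt t) k)
  =* dntr (tsd_dnt s) h ;; dntr (tsd_dnt t) h ;; dfmor (tsd_dfun H) u.
Proof.
  apply deq_tot. tot_simp. rewrite tot_dntr.
  rewrite <- tot_assoc, tot_dntr. now tot_simp.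
Qed.

Definition tsd_vcomp (X Y : tsd_ob) (F G H : tsd_mor X Y)
    (s : tsd_cell F G) (t : tsd_cell G H) : tsd_cell F H :=
  {| tsd_nt := nat_trans_comp s t;
     tsd_dnt := @Build_disp_nat_trans _ _ _ _ _ _ _ _ _ _
       (nat_trans_comp s t) (nat_trans_comp s t) _ _
       (fun x y h => dntr (tsd_dnt s) h ;; dntr (tsd_dnt t) h)
       (@tsd_vcomp_natural X Y F G H s t) |}.

Definition tsd_lwhisker (X Y Z : tsd_ob) (F : tsd_mor X Y) (G H : tsd_mor Y Z)
    (t : tsd_cell G H) : tsd_cell (tsd_comp1 F G) (tsd_comp1 F H) :=
  @make_tsd_cell _ _ (tsd_comp1 F G) (tsd_comp1 F H)
    (fun x => t (F x))
    (fun x y f => ntr_natural t (fmor F f))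
    (fun x y h => dntr (tsd_dnt t) (dfob (tsd_dfun F) h))
    (fun x1 y1 x2 y2 f1 f2 h k u =>
       dntr_natural (tsd_dnt t) (dfmor (tsd_dfun F) u)).

Lemma tsd_rwhisker_natural (X Y Z : tsd_ob) (F G : tsd_mor X Y) (H : tsd_mor Y Z)
    (t : tsd_cell F G)
    (x1 y1 x2 y2 : X) (f1 : x1 --> y1) (f2 : x2 --> y2)
    (h : tsd_disp X x1 x2) (k : tsd_disp X y1 y2) (u : dmor f1 f2 h k) :
  dfmor (tsd_dfun H) (dfmor (tsd_dfun F) u)
    ;; dfmor (tsd_dfun H) (dntr (tsd_dnt t) k)
  =* dfmor (tsd_dfun H) (dntr (tsd_dnt t) h)
    ;; dfmor (tsd_dfun H) (dfmor (tsd_dfun G) u).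
Proof.
  apply deq_tot. tot_simp. rewrite <- !tot_fun_comp. now rewrite tot_dntr.
Qed.

Definition tsd_rwhisker (X Y Z : tsd_ob) (F G : tsd_mor X Y) (H : tsd_mor Y Z)
    (t : tsd_cell F G) : tsd_cell (tsd_comp1 F H) (tsd_comp1 G H) :=
  @make_tsd_cell _ _ (tsd_comp1 F H) (tsd_comp1 G H)
    (fun x => fmor H (t x))
    (nat_trans_rwhisker_natural t H)
    (fun x y h => dfmor (tsd_dfun H) (dntr (tsd_dnt t) h))
    (@tsd_rwhisker_natural X Y Z F G H t).

(* Unitors and associators have identity components: the composites they relate
   have convertible actions. *)
Ltac identity_cell F G :=
  unshelve refine (@make_tsd_cell _ _ F G
    (fun x => idm (F x)) _ (fun x y h => did (dfob (tsd_dfun F) h)) _);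
  simpl;
  [ abstract (intros; now rewrite id_left, id_right)
  | abstract (intros; apply deq_tot; simpl; tot_simp; reflexivity) ].

Definition tsd_id2 (X Y : tsd_ob) (F : tsd_mor X Y) : tsd_cell F F.
Proof. identity_cell F F. Defined.

Definition tsd_lunitor (X Y : tsd_ob) (F : tsd_mor X Y) :
  tsd_cell (tsd_comp1 (tsd_id1 X) F) F.
Proof. identity_cell (tsd_comp1 (tsd_id1 X) F) F. Defined.

Definition tsd_linvunitor (X Y : tsd_ob) (F : tsd_mor X Y) :
  tsd_cell F (tsd_comp1 (tsd_id1 X) F).
Proof. identity_cell F (tsd_comp1 (tsd_id1 X) F). Defined.

Definition tsd_runitor (X Y : tsd_ob) (F : tsd_mor X Y) :
  tsd_cell (tsd_comp1 F (tsd_id1 Y)) F.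
Proof. identity_cell (tsd_comp1 F (tsd_id1 Y)) F. Defined.

Definition tsd_rinvunitor (X Y : tsd_ob) (F : tsd_mor X Y) :
  tsd_cell F (tsd_comp1 F (tsd_id1 Y)).
Proof. identity_cell F (tsd_comp1 F (tsd_id1 Y)). Defined.

Definition tsd_lassociator (W X Y Z : tsd_ob)
    (F : tsd_mor W X) (G : tsd_mor X Y) (H : tsd_mor Y Z) :
  tsd_cell (tsd_comp1 F (tsd_comp1 G H)) (tsd_comp1 (tsd_comp1 F G) H).
Proof.
  identity_cell (tsd_comp1 F (tsd_comp1 G H)) (tsd_comp1 (tsd_comp1 F G) H).
Defined.

Definition tsd_rassociator (W X Y Z : tsd_ob)
    (F : tsd_mor W X) (G : tsd_mor X Y) (H : tsd_mor Y Z) :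
  tsd_cell (tsd_comp1 (tsd_comp1 F G) H) (tsd_comp1 F (tsd_comp1 G H)).
Proof.
  identity_cell (tsd_comp1 (tsd_comp1 F G) H) (tsd_comp1 F (tsd_comp1 G H)).
Defined.

Ltac tsd_law :=
  intros; apply tsd_cell_eq; split; intros; simpl;
  [ cat_simp | apply deq_tot; tot_simp ];
  first [ reflexivity | apply ntr_natural | apply tot_dntr ].

Definition TwoSidedDisp : bicategory.
Proof.
  refine {| cell0 := tsd_ob; cell1 := tsd_mor; cell2 := tsd_cell;
    id1 := tsd_id1; comp1 := tsd_comp1; id2 := tsd_id2; vcomp := tsd_vcomp;
    lwhisker := tsd_lwhisker; rwhisker := tsd_rwhisker;
    lunitor := tsd_lunitor; linvunitor := tsd_linvunitor;
    runitor := tsd_runitor; rinvunitor := tsd_rinvunitor;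
    lassociator := tsd_lassociator; rassociator := tsd_rassociator;
    cell2_set := tsd_cell_set |}.
  all: abstract tsd_law.
Defined.

Record double_data (C : category) (D : twosided C C) : Type := {
  hid : forall x, D x x;
  sqid : forall x y (v : x --> y), dmor v v (hid x) (hid y);
  hcomp : forall x y z, D x y -> D y z -> D x z;
  sqcomp : forall x1 y1 z1 x2 y2 z2
    (v1 : x1 --> x2) (v2 : y1 --> y2) (v3 : z1 --> z2)
    (h1 : D x1 y1) (k1 : D y1 z1) (h2 : D x2 y2) (k2 : D y2 z2),
    dmor v1 v2 h1 h2 -> dmor v2 v3 k1 k2 ->
    dmor v1 v3 (hcomp h1 k1) (hcomp h2 k2)
}.

Arguments hid {C D} d x.
Arguments sqid {C D} d {x y} v.
Arguments hcomp {C D d x y z} _ _.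
Arguments sqcomp {C D d x1 y1 z1 x2 y2 z2 v1 v2 v3 h1 k1 h2 k2} _ _.

Notation "h ⊙ k" := (hcomp h k) (at level 40, left associativity).
Notation "s ⊡ t" := (sqcomp s t) (at level 40, left associativity).

Record double_structure (C : category) (D : twosided C C) : Type := {
  ds_data :> double_data D;
  sqid_id : forall x, sqid ds_data (idm x) = did (hid ds_data x);
  sqid_comp : forall x y z (v : x --> y) (w : y --> z),
    sqid ds_data (v · w) = sqid ds_data v ;; sqid ds_data w;
  sqcomp_id : forall x y z (h : D x y) (k : D y z),
    did h ⊡ did k = did (hcomp (d := ds_data) h k);
  sqcomp_comp : forall x1 y1 z1 x2 y2 z2 x3 y3 z3
    (v1 : x1 --> x2) (v2 : y1 --> y2) (v3 : z1 --> z2)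
    (w1 : x2 --> x3) (w2 : y2 --> y3) (w3 : z2 --> z3)
    (h1 : D x1 y1) (k1 : D y1 z1) (h2 : D x2 y2) (k2 : D y2 z2)
    (h3 : D x3 y3) (k3 : D y3 z3)
    (s1 : dmor v1 v2 h1 h2) (t1 : dmor w1 w2 h2 h3)
    (s2 : dmor v2 v3 k1 k2) (t2 : dmor w2 w3 k2 k3),
    sqcomp (d := ds_data) (s1 ;; t1) (s2 ;; t2) = (s1 ⊡ s2) ;; (t1 ⊡ t2);
  lun : forall x y (h : D x y), dmor (idm x) (idm y) (hid ds_data x ⊙ h) h;
  lun_iso : forall x y (h : D x y), is_globular_iso (lun h);
  lun_natural : forall x1 y1 x2 y2 (v : x1 --> x2) (w : y1 --> y2)
    (h : D x1 y1) (k : D x2 y2) (s : dmor v w h k),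
    (sqid ds_data v ⊡ s) ;; lun k =* lun h ;; s;
  run : forall x y (h : D x y), dmor (idm x) (idm y) (h ⊙ hid ds_data y) h;
  run_iso : forall x y (h : D x y), is_globular_iso (run h);
  run_natural : forall x1 y1 x2 y2 (v : x1 --> x2) (w : y1 --> y2)
    (h : D x1 y1) (k : D x2 y2) (s : dmor v w h k),
    (s ⊡ sqid ds_data w) ;; run k =* run h ;; s;
  ass : forall w x y z (h1 : D w x) (h2 : D x y) (h3 : D y z),
    dmor (idm w) (idm z) (h1 ⊙ (hcomp (d := ds_data) h2 h3)) (h1 ⊙ h2 ⊙ h3);
  ass_iso : forall w x y z (h1 : D w x) (h2 : D x y) (h3 : D y z),
    is_globular_iso (ass h1 h2 h3);
  ass_natural : forall w1 x1 y1 z1 w2 x2 y2 z2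
    (v1 : w1 --> w2) (v2 : x1 --> x2) (v3 : y1 --> y2) (v4 : z1 --> z2)
    (h1 : D w1 x1) (h2 : D x1 y1) (h3 : D y1 z1)
    (k1 : D w2 x2) (k2 : D x2 y2) (k3 : D y2 z2)
    (s1 : dmor v1 v2 h1 k1) (s2 : dmor v2 v3 h2 k2) (s3 : dmor v3 v4 h3 k3),
    (s1 ⊡ (s2 ⊡ s3)) ;; ass k1 k2 k3 =* ass h1 h2 h3 ;; ((s1 ⊡ s2) ⊡ s3);
  double_triangle : forall x y z (h : D x y) (k : D y z),
    did h ⊡ lun k =* ass h (hid ds_data y) k ;; (run h ⊡ did k);
  double_pentagon : forall v w x y z
    (h1 : D v w) (h2 : D w x) (h3 : D x y) (h4 : D y z),
    ass h1 h2 (h3 ⊙ h4) ;; ass (h1 ⊙ h2) h3 h4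
    =* (did h1 ⊡ ass h2 h3 h4) ;; ass h1 (h2 ⊙ h3) h4 ;; (ass h1 h2 h3 ⊡ did h4)
}.

Arguments lun {C D} d {x y} h.
Arguments run {C D} d {x y} h.
Arguments ass {C D} d {w x y z} h1 h2 h3.

Lemma deq_sqcomp (C : category) (D : twosided C C) (d : double_data D)
    x1 y1 z1 x2 y2 z2
    (v1 v1' : x1 --> x2) (v2 v2' : y1 --> y2) (v3 v3' : z1 --> z2)
    (h1 : D x1 y1) (k1 : D y1 z1) (h2 : D x2 y2) (k2 : D y2 z2)
    (s : dmor v1 v2 h1 h2) (s' : dmor v1' v2' h1 h2)
    (t : dmor v2 v3 k1 k2) (t' : dmor v2' v3' k1 k2) :
  s =* s' -> t =* t' -> sqcomp (d := d) s t =* s' ⊡ t'.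
Proof.
  intros [p [q e]] [p' [q' e']]. destruct p, q, e, q'.
  rewrite (hom_set _ _ p' eq_refl) in e'. simpl in e'. destruct e'.
  apply deq_refl.
Qed.

Lemma deq_sqid (C : category) (D : twosided C C) (d : double_data D)
    (x y : C) (v w : x --> y) : v = w -> sqid d v =* sqid d w.
Proof. intro e. destruct e. apply deq_refl. Qed.

Record double_cat : Type := {
  dc_tsd :> tsd_ob;
  dc_str : double_structure (tsd_disp dc_tsd)
}.

Record lax_structure (X Y : double_cat) (F : tsd_mor X Y) : Type := {
  lax_id : forall x : X,
    dmor (idm (F x)) (idm (F x))
      (hid (dc_str Y) (F x)) (dfob (tsd_dfun F) (hid (dc_str X) x));
  lax_comp : forall (x y z : X) (h : tsd_disp X x y) (k : tsd_disp X y z),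
    dmor (idm (F x)) (idm (F z))
      (hcomp (d := dc_str Y) (dfob (tsd_dfun F) h) (dfob (tsd_dfun F) k))
      (dfob (tsd_dfun F) (hcomp (d := dc_str X) h k));
  lax_id_natural : forall (x y : X) (v : x --> y),
    sqid (dc_str Y) (fmor F v) ;; lax_id y
    =* lax_id x ;; dfmor (tsd_dfun F) (sqid (dc_str X) v);
  lax_comp_natural : forall (x1 y1 z1 x2 y2 z2 : X)
    (v1 : x1 --> x2) (v2 : y1 --> y2) (v3 : z1 --> z2)
    (h1 : tsd_disp X x1 y1) (k1 : tsd_disp X y1 z1)
    (h2 : tsd_disp X x2 y2) (k2 : tsd_disp X y2 z2)
    (s1 : dmor v1 v2 h1 h2) (s2 : dmor v2 v3 k1 k2),
    (dfmor (tsd_dfun F) s1 ⊡ dfmor (tsd_dfun F) s2) ;; lax_comp h2 k2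
    =* lax_comp h1 k1 ;; dfmor (tsd_dfun F) (s1 ⊡ s2);
  lax_lun : forall (x y : X) (h : tsd_disp X x y),
    lun (dc_str Y) (dfob (tsd_dfun F) h)
    =* (lax_id x ⊡ did (dfob (tsd_dfun F) h))
       ;; lax_comp (hid (dc_str X) x) h
       ;; dfmor (tsd_dfun F) (lun (dc_str X) h);
  lax_run : forall (x y : X) (h : tsd_disp X x y),
    run (dc_str Y) (dfob (tsd_dfun F) h)
    =* (did (dfob (tsd_dfun F) h) ⊡ lax_id y)
       ;; lax_comp h (hid (dc_str X) y)
       ;; dfmor (tsd_dfun F) (run (dc_str X) h);
  lax_ass : forall (w x y z : X)
    (h1 : tsd_disp X w x) (h2 : tsd_disp X x y) (h3 : tsd_disp X y z),
    ass (dc_str Y) (dfob (tsd_dfun F) h1) (dfob (tsd_dfun F) h2)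
        (dfob (tsd_dfun F) h3)
      ;; (lax_comp h1 h2 ⊡ did (dfob (tsd_dfun F) h3))
      ;; lax_comp (h1 ⊙ h2) h3
    =* (did (dfob (tsd_dfun F) h1) ⊡ lax_comp h2 h3)
       ;; lax_comp h1 (h2 ⊙ h3)
       ;; dfmor (tsd_dfun F) (ass (dc_str X) h1 h2 h3)
}.

Arguments lax_id {X Y F} l x.
Arguments lax_comp {X Y F} l {x y z} h k.

Record lax_double_functor (X Y : double_cat) : Type := {
  ldf_mor :> tsd_mor X Y;
  ldf_lax : lax_structure ldf_mor
}.

Arguments ldf_lax {X Y} l.

Record is_double_trans (X Y : double_cat) (F G : lax_double_functor X Y)
    (t : tsd_cell F G) : Prop := {
  double_trans_id : forall x : X,
    lax_id (ldf_lax F) x ;; dntr (tsd_dnt t) (hid (dc_str X) x)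
    =* sqid (dc_str Y) (t x) ;; lax_id (ldf_lax G) x;
  double_trans_comp : forall (x y z : X)
    (h : tsd_disp X x y) (k : tsd_disp X y z),
    lax_comp (ldf_lax F) h k ;; dntr (tsd_dnt t) (h ⊙ k)
    =* (dntr (tsd_dnt t) h ⊡ dntr (tsd_dnt t) k) ;; lax_comp (ldf_lax G) h k
}.

Record double_trans (X Y : double_cat) (F G : lax_double_functor X Y) : Type := {
  dtr_cell :> tsd_cell F G;
  dtr_law : is_double_trans dtr_cell
}.

Lemma is_hprop_is_double_trans (X Y : double_cat) (F G : lax_double_functor X Y)
    (t : tsd_cell F G) : is_hprop (is_double_trans t).
Proof.
  intros [a b] [a' b']. f_equal;
    repeat (apply is_hprop_forall; intro); apply is_hprop_deq.
Qed.

Lemma double_trans_eq (X Y : double_cat) (F G : lax_double_functor X Y)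
    (s t : double_trans F G) : dtr_cell s = dtr_cell t -> s = t.
Proof.
  destruct s as [s p], t as [t q]. simpl. intro e. destruct e.
  f_equal. apply is_hprop_is_double_trans.
Qed.

Lemma double_trans_set (X Y : double_cat) (F G : lax_double_functor X Y) :
  is_hset (double_trans F G).
Proof.
  apply is_hset_of_rel with (R := fun s t => dtr_cell s = dtr_cell t).
  - intros s t. apply tsd_cell_set.
  - reflexivity.
  - apply double_trans_eq.
Qed.

Section TotCompEq.
Variables (C1 C2 : category) (D : twosided C1 C2).
Variables (x1 y1 z1 w1 v1 : C1) (x2 y2 z2 w2 v2 : C2).
Variables (xx : D x1 x2) (yy : D y1 y2) (zz : D z1 z2) (ww : D w1 w2)
  (vv : D v1 v2).

Lemma tot_comp_eq2 (s : tot_hom xx yy) (t : tot_hom yy zz) (r : tot_hom xx zz)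
    (a : tot_hom ww xx) :
  tot_comp s t = r -> tot_comp (tot_comp a s) t = tot_comp a r.
Proof. intro e. now rewrite <- tot_assoc, e. Qed.

Lemma tot_comp_eq3 (s : tot_hom xx yy) (t : tot_hom yy zz) (u : tot_hom zz vv)
    (r : tot_hom xx vv) (a : tot_hom ww xx) :
  tot_comp (tot_comp s t) u = r ->
  tot_comp (tot_comp (tot_comp a s) t) u = tot_comp a r.
Proof. intro e. now rewrite <- e, !tot_assoc. Qed.

End TotCompEq.

Lemma tot_square (C1 C2 : category) (D : twosided C1 C2)
    x1 y1 y1' z1 x2 y2 y2' z2
    (f1 : x1 --> y1) (f2 : x2 --> y2) (g1 : y1 --> z1) (g2 : y2 --> z2)
    (f1' : x1 --> y1') (f2' : x2 --> y2') (g1' : y1' --> z1) (g2' : y2' --> z2)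
    (xx : D x1 x2) (yy : D y1 y2) (yy' : D y1' y2') (zz : D z1 z2)
    (u : dmor f1 f2 xx yy) (v : dmor g1 g2 yy zz)
    (u' : dmor f1' f2' xx yy') (v' : dmor g1' g2' yy' zz) :
  u ;; v =* u' ;; v' ->
  tot_comp (tot u) (tot v) = tot_comp (tot u') (tot v').
Proof. apply tot_eq. Qed.

Definition lax_structure_id (X : double_cat) : lax_structure (tsd_id1 X).
Proof.
  unshelve refine (@Build_lax_structure X X (tsd_id1 X)
    (fun x => did (hid (dc_str X) x))
    (fun x y z h k => did (hcomp (d := dc_str X) h k)) _ _ _ _ _);
  abstract (intros; apply deq_tot; simpl; rewrite ?sqcomp_id; tot_simp;
            rewrite ?sqcomp_id; tot_simp; reflexivity).
Defined.

Definition dc_id1 (X : double_cat) : lax_double_functor X X :=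
  {| ldf_mor := tsd_id1 X; ldf_lax := lax_structure_id X |}.

Section LaxComp.
Variables (X Y Z : double_cat) (F : lax_double_functor X Y)
  (G : lax_double_functor Y Z).

Local Notation FF := (tsd_dfun F).
Local Notation GG := (tsd_dfun G).
Local Notation "s ⊠ t" := (sqcomp (d := dc_str Z) s t)
  (at level 40, left associativity).

(* The evident squares lie over [id · G id]; [dcast] moves them over [id]. *)
Lemma lax_comp_over_id (x : X) :
  idm (G (F x)) · fmor G (idm (F x)) = idm (G (F x)).
Proof. now cat_simp. Qed.

Definition lax_comp_id (x : X) :
    dmor (idm (G (F x))) (idm (G (F x))) (hid (dc_str Z) (G (F x)))
      (dfob GG (dfob FF (hid (dc_str X) x))) :=
  dcast (lax_comp_over_id x) (lax_comp_over_id x)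
    (lax_id (ldf_lax G) (F x) ;; dfmor GG (lax_id (ldf_lax F) x)).

Definition lax_comp_comp (x y z : X) (h : tsd_disp X x y) (k : tsd_disp X y z) :
    dmor (idm (G (F x))) (idm (G (F z)))
      (hcomp (d := dc_str Z) (dfob GG (dfob FF h)) (dfob GG (dfob FF k)))
      (dfob GG (dfob FF (hcomp (d := dc_str X) h k))) :=
  dcast (lax_comp_over_id x) (lax_comp_over_id z)
    (lax_comp (ldf_lax G) (dfob FF h) (dfob FF k)
     ;; dfmor GG (lax_comp (ldf_lax F) h k)).

Lemma lax_comp_id_natural (x y : X) (v : x --> y) :
  sqid (dc_str Z) (fmor G (fmor F v)) ;; lax_comp_id y
  =* lax_comp_id x ;; dfmor GG (dfmor FF (sqid (dc_str X) v)).
Proof.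
  apply deq_tot. unfold lax_comp_id. tot_simp.
  rewrite (tot_square (lax_id_natural (ldf_lax G) (fmor F v))).
  rewrite <- !tot_assoc. f_equal.
  rewrite tot_dfmor, <- !tot_fun_comp. f_equal.
  apply (tot_eq (lax_id_natural (ldf_lax F) v)).
Qed.

Lemma lax_comp_comp_natural (x1 y1 z1 x2 y2 z2 : X)
    (v1 : x1 --> x2) (v2 : y1 --> y2) (v3 : z1 --> z2)
    (h1 : tsd_disp X x1 y1) (k1 : tsd_disp X y1 z1)
    (h2 : tsd_disp X x2 y2) (k2 : tsd_disp X y2 z2)
    (s1 : dmor v1 v2 h1 h2) (s2 : dmor v2 v3 k1 k2) :
  (dfmor GG (dfmor FF s1) ⊡ dfmor GG (dfmor FF s2)) ;; lax_comp_comp h2 k2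
  =* lax_comp_comp h1 k1 ;; dfmor GG (dfmor FF (s1 ⊡ s2)).
Proof.
  apply deq_tot. unfold lax_comp_comp. tot_simp.
  rewrite (tot_square (lax_comp_natural (ldf_lax G) (dfmor FF s1) (dfmor FF s2))).
  rewrite <- !tot_assoc. f_equal.
  rewrite tot_dfmor, <- !tot_fun_comp. f_equal.
  apply (tot_eq (lax_comp_natural (ldf_lax F) s1 s2)).
Qed.

Lemma lax_comp_id_did (x y : X) (h : tsd_disp X x y) :
  tot (lax_comp_id x ⊠ did (dfob GG (dfob FF h)))
  = tot_comp (tot (lax_id (ldf_lax G) (F x) ⊠ did (dfob GG (dfob FF h))))
             (tot (dfmor GG (lax_id (ldf_lax F) x) ⊠ dfmor GG (did (dfob FF h)))).
Proof.
  rewrite <- tot_dcomp, <- sqcomp_comp. apply tot_eq, deq_sqcomp.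
  - apply deq_cast.
  - apply deq_tot. now tot_simp.
Qed.

Lemma did_lax_comp_id (x y : X) (h : tsd_disp X x y) :
  tot (did (dfob GG (dfob FF h)) ⊠ lax_comp_id y)
  = tot_comp (tot (did (dfob GG (dfob FF h)) ⊠ lax_id (ldf_lax G) (F y)))
             (tot (dfmor GG (did (dfob FF h)) ⊠ dfmor GG (lax_id (ldf_lax F) y))).
Proof.
  rewrite <- tot_dcomp, <- sqcomp_comp. apply tot_eq, deq_sqcomp.
  - apply deq_tot. now tot_simp.
  - apply deq_cast.
Qed.

Lemma lax_comp_comp_did (w x y z : X)
    (h : tsd_disp X w x) (k : tsd_disp X x y) (l : tsd_disp X y z) :
  tot (lax_comp_comp h k ⊠ did (dfob GG (dfob FF l)))
  = tot_comp
      (tot (lax_comp (ldf_lax G) (dfob FF h) (dfob FF k) ⊠ did (dfob GG (dfob FF l))))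
      (tot (dfmor GG (lax_comp (ldf_lax F) h k) ⊠ dfmor GG (did (dfob FF l)))).
Proof.
  rewrite <- tot_dcomp, <- sqcomp_comp. apply tot_eq, deq_sqcomp.
  - apply deq_cast.
  - apply deq_tot. now tot_simp.
Qed.

Lemma did_lax_comp_comp (w x y z : X)
    (h : tsd_disp X w x) (k : tsd_disp X x y) (l : tsd_disp X y z) :
  tot (did (dfob GG (dfob FF h)) ⊠ lax_comp_comp k l)
  = tot_comp
      (tot (did (dfob GG (dfob FF h)) ⊠ lax_comp (ldf_lax G) (dfob FF k) (dfob FF l)))
      (tot (dfmor GG (did (dfob FF h)) ⊠ dfmor GG (lax_comp (ldf_lax F) k l))).
Proof.
  rewrite <- tot_dcomp, <- sqcomp_comp. apply tot_eq, deq_sqcomp.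
  - apply deq_tot. now tot_simp.
  - apply deq_cast.
Qed.

Lemma lax_comp_lun (x y : X) (h : tsd_disp X x y) :
  lun (dc_str Z) (dfob GG (dfob FF h))
  =* (lax_comp_id x ⊡ did (dfob GG (dfob FF h)))
     ;; lax_comp_comp (hid (dc_str X) x) h
     ;; dfmor GG (dfmor FF (lun (dc_str X) h)).
Proof.
  apply deq_tot. rewrite (tot_eq (lax_lun (ldf_lax G) (dfob FF h))).
  rewrite !tot_dcomp, lax_comp_id_did. unfold lax_comp_comp. tot_simp.
  rewrite (tot_comp_eq2 _
    (tot_square (lax_comp_natural (ldf_lax G) (lax_id (ldf_lax F) x)
                              (did (dfob FF h))))).
  rewrite <- !tot_assoc. do 2 f_equal.
  rewrite !tot_dfmor, <- !tot_fun_comp. f_equal.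
  rewrite tot_assoc.
  apply (tot_eq (lax_lun (ldf_lax F) h)).
Qed.

Lemma lax_comp_run (x y : X) (h : tsd_disp X x y) :
  run (dc_str Z) (dfob GG (dfob FF h))
  =* (did (dfob GG (dfob FF h)) ⊡ lax_comp_id y)
     ;; lax_comp_comp h (hid (dc_str X) y)
     ;; dfmor GG (dfmor FF (run (dc_str X) h)).
Proof.
  apply deq_tot. rewrite (tot_eq (lax_run (ldf_lax G) (dfob FF h))).
  rewrite !tot_dcomp, did_lax_comp_id. unfold lax_comp_comp. tot_simp.
  rewrite (tot_comp_eq2 _
    (tot_square (lax_comp_natural (ldf_lax G) (did (dfob FF h))
                              (lax_id (ldf_lax F) y)))).
  rewrite <- !tot_assoc. do 2 f_equal.
  rewrite !tot_dfmor, <- !tot_fun_comp. f_equal.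
  rewrite tot_assoc.
  apply (tot_eq (lax_run (ldf_lax F) h)).
Qed.

Lemma lax_comp_ass (w x y z : X)
    (h1 : tsd_disp X w x) (h2 : tsd_disp X x y) (h3 : tsd_disp X y z) :
  ass (dc_str Z) (dfob GG (dfob FF h1)) (dfob GG (dfob FF h2))
      (dfob GG (dfob FF h3))
    ;; (lax_comp_comp h1 h2 ⊡ did (dfob GG (dfob FF h3)))
    ;; lax_comp_comp (h1 ⊙ h2) h3
  =* (did (dfob GG (dfob FF h1)) ⊡ lax_comp_comp h2 h3)
     ;; lax_comp_comp h1 (h2 ⊙ h3)
     ;; dfmor GG (dfmor FF (ass (dc_str X) h1 h2 h3)).
Proof.
  apply deq_tot.
  rewrite !tot_dcomp, lax_comp_comp_did, did_lax_comp_comp.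
  unfold lax_comp_comp. tot_simp.
  rewrite (tot_comp_eq2 _
    (tot_square (lax_comp_natural (ldf_lax G) (lax_comp (ldf_lax F) h1 h2)
                              (did (dfob FF h3))))).
  rewrite (tot_comp_eq2 _
    (tot_square (lax_comp_natural (ldf_lax G) (did (dfob FF h1))
                              (lax_comp (ldf_lax F) h2 h3)))).
  rewrite !tot_assoc.
  generalize (tot_eq (lax_ass (ldf_lax G) (dfob FF h1) (dfob FF h2)
                              (dfob FF h3))).
  rewrite !tot_dcomp. intro e. rewrite e. clear e.
  rewrite <- !tot_assoc. do 2 f_equal.
  rewrite !tot_dfmor, <- !tot_fun_comp. f_equal.
  rewrite !tot_assoc.
  apply (tot_eq (lax_ass (ldf_lax F) h1 h2 h3)).
Qed.

Definition lax_structure_comp : lax_structure (tsd_comp1 F G) :=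
  @Build_lax_structure X Z (tsd_comp1 F G) lax_comp_id lax_comp_comp
    lax_comp_id_natural lax_comp_comp_natural
    lax_comp_lun lax_comp_run lax_comp_ass.

Definition dc_comp1 : lax_double_functor X Z :=
  {| ldf_mor := tsd_comp1 F G; ldf_lax := lax_structure_comp |}.

End LaxComp.

Definition dc_id2 (X Y : double_cat) (F : lax_double_functor X Y) :
  double_trans F F.
Proof.
  exists (tsd_id2 F).
  abstract (split; intros; apply deq_tot; simpl;
    rewrite ?sqid_id, ?sqcomp_id; tot_simp; reflexivity).
Defined.

Lemma dc_vcomp_law (X Y : double_cat) (F G H : lax_double_functor X Y)
    (s : double_trans F G) (t : double_trans G H) :
  is_double_trans (F := F) (G := H) (tsd_vcomp s t).
Proof.
  split; intros; apply deq_tot; simpl.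
  - rewrite sqid_comp. tot_simp.
    generalize (tot_eq (double_trans_id (dtr_law s) x)).
    rewrite !tot_dcomp. intro e. rewrite e, <- !tot_assoc. f_equal.
    apply (tot_eq (double_trans_id (dtr_law t) x)).
  - rewrite sqcomp_comp. tot_simp.
    generalize (tot_eq (double_trans_comp (dtr_law s) h k)).
    rewrite !tot_dcomp. intro e. rewrite e, <- !tot_assoc. f_equal.
    apply (tot_eq (double_trans_comp (dtr_law t) h k)).
Qed.

Definition dc_vcomp (X Y : double_cat) (F G H : lax_double_functor X Y)
    (s : double_trans F G) (t : double_trans G H) : double_trans F H :=
  {| dtr_cell := tsd_vcomp s t; dtr_law := dc_vcomp_law s t |}.

Lemma dc_lwhisker_law (X Y Z : double_cat) (F : lax_double_functor X Y)
    (G H : lax_double_functor Y Z) (t : double_trans G H) :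
  is_double_trans (F := dc_comp1 F G) (G := dc_comp1 F H) (tsd_lwhisker F t).
Proof.
  split; intros; apply deq_tot; simpl;
    unfold lax_comp_id, lax_comp_comp; tot_simp;
    rewrite <- tot_assoc, tot_dntr, tot_assoc; f_equal.
  - apply (tot_eq (double_trans_id (dtr_law t) (F x))).
  - apply (tot_eq (double_trans_comp (dtr_law t) (dfob (tsd_dfun F) h)
                                     (dfob (tsd_dfun F) k))).
Qed.

Definition dc_lwhisker (X Y Z : double_cat) (F : lax_double_functor X Y)
    (G H : lax_double_functor Y Z) (t : double_trans G H) :
    double_trans (dc_comp1 F G) (dc_comp1 F H) :=
  @Build_double_trans _ _ (dc_comp1 F G) (dc_comp1 F H)
    (tsd_lwhisker F t) (dc_lwhisker_law F t).

Lemma dc_rwhisker_law (X Y Z : double_cat) (F G : lax_double_functor X Y)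
    (H : lax_double_functor Y Z) (t : double_trans F G) :
  is_double_trans (F := dc_comp1 F H) (G := dc_comp1 G H) (tsd_rwhisker H t).
Proof.
  split; intros; apply deq_tot; simpl;
    unfold lax_comp_id, lax_comp_comp; tot_simp;
    rewrite <- tot_assoc, <- tot_fun_comp.
  - rewrite <- tot_dcomp, (tot_eq (double_trans_id (dtr_law t) x)).
    rewrite tot_dcomp, tot_fun_comp, tot_assoc. f_equal.
    symmetry. apply (tot_eq (lax_id_natural (ldf_lax H) (t x))).
  - rewrite <- tot_dcomp, (tot_eq (double_trans_comp (dtr_law t) h k)).
    rewrite tot_dcomp, tot_fun_comp, tot_assoc. f_equal.
    symmetry. apply (tot_eq (lax_comp_natural (ldf_lax H)
                     (dntr (tsd_dnt t) h) (dntr (tsd_dnt t) k))).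
Qed.

Definition dc_rwhisker (X Y Z : double_cat) (F G : lax_double_functor X Y)
    (H : lax_double_functor Y Z) (t : double_trans F G) :
    double_trans (dc_comp1 F H) (dc_comp1 G H) :=
  @Build_double_trans _ _ (dc_comp1 F H) (dc_comp1 G H)
    (tsd_rwhisker H t) (dc_rwhisker_law H t).

Ltac identity_double_law :=
  split; intros; apply deq_tot; simpl;
  do 2 (unfold lax_comp_id, lax_comp_comp; simpl; tot_simp);
  rewrite ?sqid_id, ?sqcomp_id; tot_simp; reflexivity.

Definition dc_lunitor (X Y : double_cat) (F : lax_double_functor X Y) :
  double_trans (dc_comp1 (dc_id1 X) F) F.
Proof. exists (tsd_lunitor F). abstract identity_double_law. Defined.

Definition dc_linvunitor (X Y : double_cat) (F : lax_double_functor X Y) :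
  double_trans F (dc_comp1 (dc_id1 X) F).
Proof. exists (tsd_linvunitor F). abstract identity_double_law. Defined.

Definition dc_runitor (X Y : double_cat) (F : lax_double_functor X Y) :
  double_trans (dc_comp1 F (dc_id1 Y)) F.
Proof. exists (tsd_runitor F). abstract identity_double_law. Defined.

Definition dc_rinvunitor (X Y : double_cat) (F : lax_double_functor X Y) :
  double_trans F (dc_comp1 F (dc_id1 Y)).
Proof. exists (tsd_rinvunitor F). abstract identity_double_law. Defined.

Definition dc_lassociator (W X Y Z : double_cat) (F : lax_double_functor W X)
    (G : lax_double_functor X Y) (H : lax_double_functor Y Z) :
  double_trans (dc_comp1 F (dc_comp1 G H)) (dc_comp1 (dc_comp1 F G) H).
Proof. exists (tsd_lassociator F G H). abstract identity_double_law. Defined.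

Definition dc_rassociator (W X Y Z : double_cat) (F : lax_double_functor W X)
    (G : lax_double_functor X Y) (H : lax_double_functor Y Z) :
  double_trans (dc_comp1 (dc_comp1 F G) H) (dc_comp1 F (dc_comp1 G H)).
Proof. exists (tsd_rassociator F G H). abstract identity_double_law. Defined.

Ltac dc_law :=
  intros; apply double_trans_eq;
  first [ apply (@id2_left TwoSidedDisp) | apply (@id2_right TwoSidedDisp)
  | apply (@vassoc TwoSidedDisp)
  | apply (@lwhisker_id2 TwoSidedDisp) | apply (@id2_rwhisker TwoSidedDisp)
  | apply (@lwhisker_vcomp TwoSidedDisp) | apply (@rwhisker_vcomp TwoSidedDisp)
  | apply (@vcomp_lunitor TwoSidedDisp) | apply (@vcomp_runitor TwoSidedDisp)
  | apply (@lwhisker_lwhisker TwoSidedDisp)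
  | apply (@rwhisker_lwhisker TwoSidedDisp)
  | apply (@rwhisker_rwhisker TwoSidedDisp)
  | apply (@vcomp_whisker TwoSidedDisp)
  | apply (@lunitor_linvunitor TwoSidedDisp)
  | apply (@linvunitor_lunitor TwoSidedDisp)
  | apply (@runitor_rinvunitor TwoSidedDisp)
  | apply (@rinvunitor_runitor TwoSidedDisp)
  | apply (@lassociator_rassociator TwoSidedDisp)
  | apply (@rassociator_lassociator TwoSidedDisp)
  | apply (@runitor_rwhisker TwoSidedDisp)
  | apply (@lassociator_lassociator TwoSidedDisp) ].

Definition DoubleCat : bicategory.
Proof.
  refine {| cell0 := double_cat; cell1 := lax_double_functor;
    cell2 := double_trans; id1 := dc_id1; comp1 := dc_comp1; id2 := dc_id2;
    vcomp := dc_vcomp; lwhisker := dc_lwhisker; rwhisker := dc_rwhisker;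
    lunitor := dc_lunitor; linvunitor := dc_linvunitor;
    runitor := dc_runitor; rinvunitor := dc_rinvunitor;
    lassociator := dc_lassociator; rassociator := dc_rassociator;
    cell2_set := double_trans_set |}.
  all: abstract dc_law.
Defined.

Definition is_strong (X Y : double_cat) (F : lax_double_functor X Y) : Prop :=
  (forall x : X, is_globular_iso (lax_id (ldf_lax F) x)) /\
  (forall (x y z : X) (h : tsd_disp X x y) (k : tsd_disp X y z),
     is_globular_iso (lax_comp (ldf_lax F) h k)).

(* Main.v *)
(* Doctrinal adjunction.  If L has a right adjoint R in DoubleCat, then
   L(η ⊙ η) · L(R_comp) · ε inverts L_comp, and similarly for L_id.  Conversely,
   let R be right adjoint to the underlying 1-cell of a strong L.  Transposition
   u |-> L(u) · ε is injective on squares into R(k), and R_comp is defined by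
   requiring L_comp · L(R_comp) · ε = ε ⊙ ε, which is possible since L_comp is
   invertible; likewise for R_id.  Every law for R and for the unit can then be
   checked after transposition and after precomposition with L_comp and L_id,
   while the counit is compatible with R_comp and R_id by construction.  Finally,
   the inverse of an invertible 2-cell of TwoSidedDisp that respects the lax
   structures respects them too. *)

From Stdlib Require Import IndefiniteDescription.
Require Import Defs.

Set Implicit Arguments.
Unset Strict Implicit.
Unset Printing Implicit Defensive.

(** * Invertible globular squares *)

Section GlobularIso.
Variables (C1 C2 : category) (D : twosided C1 C2).

(** A candidate inverse built as a composite lies over base morphisms that are only provably
    identities; [dcast] along [p] and [q] makes it globular and leaves its total square
    unchanged. *)
Lemma globular_iso_of_tot (x1 : C1) (x2 : C2) (xx yy : D x1 x2)
    (u : dmor (idm x1) (idm x2) xx yy) (v : tot_hom yy xx) :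
  tot_comp (tot u) v = tot_id xx -> tot_comp v (tot u) = tot_id yy ->
  fst (projT1 v) = idm x1 -> snd (projT1 v) = idm x2 -> is_globular_iso u.
Proof.
  destruct v as [[f1 f2] v]; simpl. intros e e' p q.
  exists (dcast p q v). split; apply deq_tot;
    now rewrite tot_dcomp, tot_dcast.
Qed.

(** Composing with the inverse of [u] on the left cancels [u]. This is what allows laws to be
    checked after precomposition with the comparison squares of a strong functor. *)
Lemma globular_iso_epi (x1 y1 : C1) (x2 y2 : C2) (xx yy : D x1 x2)
    (zz : D y1 y2) (u : dmor (idm x1) (idm x2) xx yy) (s t : tot_hom yy zz) :
  is_globular_iso u -> tot_comp (tot u) s = tot_comp (tot u) t -> s = t.
Proof.
  intros [v [_ e]] E. apply tot_eq in e. rewrite tot_dcomp in e.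
  rewrite <- (tot_id_left s), <- (tot_id_left t).
  change (tot_id yy) with (tot (did yy)). rewrite <- e, <- !tot_assoc.
  now f_equal.
Qed.

(* Inverses are unique, but [is_globular_iso] lives in [Prop]: extracting them
   as data takes a choice principle. *)
Definition globular_inv (x1 : C1) (x2 : C2) (xx yy : D x1 x2)
    (u : dmor (idm x1) (idm x2) xx yy) (hu : is_globular_iso u) :
    dmor (idm x1) (idm x2) yy xx :=
  proj1_sig (constructive_indefinite_description _ hu).

Lemma globular_inv_right (x1 : C1) (x2 : C2) (xx yy : D x1 x2)
    (u : dmor (idm x1) (idm x2) xx yy) (hu : is_globular_iso u) :
  tot_comp (tot u) (tot (globular_inv hu)) = tot_id xx.
Proof.
  exact (tot_eq (proj1 (proj2_sig (constructive_indefinite_description _ hu)))).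
Qed.

End GlobularIso.

(** * Horizontal composition and functor actions on total squares *)

Section TotSquareCalculus.
Variables (C : category) (D : twosided C C) (d : double_structure D).

(** Horizontal composition does not extend to [tot_hom], since the two squares must share their
    middle boundary by typing. Equalities of total squares are therefore passed to representatives,
    [v2] and [v2'] being allowed to differ. *)
Lemma tot_sqcomp_eq x1 y1 z1 x2 y2 z2
    (v1 v1' : x1 --> x2) (v2 v2' : y1 --> y2) (v3 v3' : z1 --> z2)
    (h1 : D x1 y1) (k1 : D y1 z1) (h2 : D x2 y2) (k2 : D y2 z2)
    (s : dmor v1 v2 h1 h2) (s' : dmor v1' v2' h1 h2)
    (t : dmor v2 v3 k1 k2) (t' : dmor v2' v3' k1 k2) :
  tot s = tot s' -> tot t = tot t' ->
  tot (sqcomp (d := d) s t) = tot (sqcomp (d := d) s' t').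
Proof. intros e e'. apply tot_eq, deq_sqcomp; now apply deq_tot. Qed.

Lemma tot_sqcomp_comp x1 y1 z1 x2 y2 z2 x3 y3 z3
    (v1 : x1 --> x2) (v2 : y1 --> y2) (v3 : z1 --> z2)
    (w1 : x2 --> x3) (w2 : y2 --> y3) (w3 : z2 --> z3)
    (h1 : D x1 y1) (k1 : D y1 z1) (h2 : D x2 y2) (k2 : D y2 z2)
    (h3 : D x3 y3) (k3 : D y3 z3)
    (s1 : dmor v1 v2 h1 h2) (t1 : dmor w1 w2 h2 h3)
    (s2 : dmor v2 v3 k1 k2) (t2 : dmor w2 w3 k2 k3) :
  tot_comp (tot (sqcomp (d := d) s1 s2)) (tot (sqcomp (d := d) t1 t2))
  = tot (sqcomp (d := d) (s1 ;; t1) (s2 ;; t2)).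
Proof. now rewrite sqcomp_comp. Qed.

Lemma tot_sqid_eq x y (v w : x --> y) :
  v = w -> tot (sqid d v) = tot (sqid d w).
Proof. now intros []. Qed.

Lemma tot_sqid_comp x y z (v : x --> y) (w : y --> z) :
  tot_comp (tot (sqid d v)) (tot (sqid d w)) = tot (sqid d (v · w)).
Proof. now rewrite sqid_comp. Qed.

(** By interchange, the inverses compose horizontally to an inverse. *)
Lemma globular_iso_sqcomp (x y z : C) (h h' : D x y) (k k' : D y z)
    (u : dmor (idm x) (idm y) h h') (v : dmor (idm y) (idm z) k k') :
  is_globular_iso u -> is_globular_iso v ->
  is_globular_iso (sqcomp (d := d) u v).
Proof.
  intros [u' [a b]] [v' [a' b']]. exists (sqcomp (d := d) u' v').
  simpl in *. rewrite <- !sqcomp_comp, <- !sqcomp_id.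
  split; now apply deq_sqcomp.
Qed.

End TotSquareCalculus.

(** Unlike [tot_fun_comp], this form keeps each square under [dfmor], where the naturality and
    coherence laws of lax functors match it syntactically. *)
Lemma tot_dfmor_comp (C1 C2 C1' C2' : category) (F1 : functor C1 C1')
    (F2 : functor C2 C2') (D : twosided C1 C2) (D' : twosided C1' C2')
    (FF : disp_functor F1 F2 D D')
    x1 y1 z1 x2 y2 z2 (f1 : x1 --> y1) (f2 : x2 --> y2) (g1 : y1 --> z1)
    (g2 : y2 --> z2) (xx : D x1 x2) (yy : D y1 y2) (zz : D z1 z2)
    (u : dmor f1 f2 xx yy) (v : dmor g1 g2 yy zz) :
  tot (dfmor FF (u ;; v)) = tot_comp (tot (dfmor FF u)) (tot (dfmor FF v)).
Proof. apply (tot_eq (dfmor_comp FF u v)). Qed.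

Lemma tot_dfmor_did (C1 C2 C1' C2' : category) (F1 : functor C1 C1')
    (F2 : functor C2 C2') (D : twosided C1 C2) (D' : twosided C1' C2')
    (FF : disp_functor F1 F2 D D') x1 x2 (xx : D x1 x2) :
  tot (dfmor FF (did xx)) = tot (did (dfob FF xx)).
Proof. apply (tot_eq (dfmor_id FF xx)). Qed.

(** * Adjunctions in [TwoSidedDisp] by components, and transposition of squares *)

Section CellComponents.
Variables (X Y : tsd_ob) (F G : tsd_mor X Y) (s t : tsd_cell F G).

Lemma tsd_cell_eq_at (e : s = t) (x : X) : s x = t x.
Proof. now rewrite e. Qed.

Lemma tsd_cell_eq_disp (e : s = t) (x y : X) (h : tsd_disp X x y) :
  tot (dntr (tsd_dnt s) h) = tot (dntr (tsd_dnt t) h).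
Proof. now rewrite e. Qed.

End CellComponents.

Section Adjunction.
Variables (X Y : tsd_ob) (L : tsd_mor X Y)
  (r : right_adjoint (B := TwoSidedDisp) (x := X) (y := Y) L).

Definition tsd_radj : tsd_mor Y X := radj r.
Definition tsd_unit : tsd_cell (tsd_id1 X) (tsd_comp1 L tsd_radj) := adj_unit r.
Definition tsd_counit : tsd_cell (tsd_comp1 tsd_radj L) (tsd_id1 Y) :=
  adj_counit r.

Local Notation R := tsd_radj.
Local Notation L0 := (dfob (tsd_dfun L)).
Local Notation R0 := (dfob (tsd_dfun R)).
Local Notation L1 := (dfmor (tsd_dfun L)).
Local Notation R1 := (dfmor (tsd_dfun R)).

(* The components of the unit and counit with the composite functors unfolded,
   so that rewriting does not have to see through [tsd_comp1]. *)
Definition unit_at (x : X) : x --> R (L x) := tsd_unit x.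
Definition counit_at (y : Y) : L (R y) --> y := tsd_counit y.
Definition unit_sq (x y : X) (h : tsd_disp X x y) :
    dmor (unit_at x) (unit_at y) h (R0 (L0 h)) :=
  dntr (tsd_dnt tsd_unit) h.
Definition counit_sq (x y : Y) (h : tsd_disp Y x y) :
    dmor (counit_at x) (counit_at y) (L0 (R0 h)) h :=
  dntr (tsd_dnt tsd_counit) h.

(** Unitors and associators have identity components, so normalisation removes them from the
    bicategorical triangle law. *)
Lemma triangle_l_at (x : X) : fmor L (unit_at x) · counit_at (L x) = idm (L x).
Proof.
  generalize (tsd_cell_eq_at (adj_triangle_l r) x). simpl. now cat_simp.
Qed.

Lemma triangle_r_at (y : Y) : unit_at (R y) · fmor R (counit_at y) = idm (R y).
Proof.
  generalize (tsd_cell_eq_at (adj_triangle_r r) y). simpl. now cat_simp.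
Qed.

Lemma triangle_l_sq (x y : X) (h : tsd_disp X x y) :
  tot_comp (tot (L1 (unit_sq h))) (tot (counit_sq (L0 h))) = tot_id (L0 h).
Proof.
  generalize (tsd_cell_eq_disp (adj_triangle_l r) h). simpl. now tot_simp.
Qed.

Lemma triangle_r_sq (x y : Y) (h : tsd_disp Y x y) :
  tot_comp (tot (unit_sq (R0 h))) (tot (R1 (counit_sq h))) = tot_id (R0 h).
Proof.
  generalize (tsd_cell_eq_disp (adj_triangle_r r) h). simpl. now tot_simp.
Qed.

Lemma counit_at_natural (x y : Y) (f : x --> y) :
  fmor L (fmor R f) · counit_at y = counit_at x · f.
Proof. exact (ntr_natural tsd_counit f). Qed.

Lemma unit_sq_natural x1 y1 x2 y2 (h : tsd_disp X x1 x2) (k : tsd_disp X y1 y2)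
    (s : tot_hom h k) :
  tot_comp s (tot (unit_sq k))
  = tot_comp (tot (unit_sq h))
             (tot_fun (tsd_dfun R) (tot_fun (tsd_dfun L) s)).
Proof. destruct s as [[f1 f2] u]. exact (tot_dntr (tsd_dnt tsd_unit) u). Qed.

Lemma counit_sq_natural x1 y1 x2 y2
    (h : tsd_disp Y x1 x2) (k : tsd_disp Y y1 y2) (s : tot_hom h k) :
  tot_comp (tot_fun (tsd_dfun L) (tot_fun (tsd_dfun R) s)) (tot (counit_sq k))
  = tot_comp (tot (counit_sq h)) s.
Proof. destruct s as [[f1 f2] u]. exact (tot_dntr (tsd_dnt tsd_counit) u). Qed.

(** Naturality of ε turns L(η · R(s)) · ε into L(η) · ε · s, and the left triangle law removes L(η)
    · ε. *)
Lemma transpose_unit x1 y1 x2 y2 (h : tsd_disp X x1 x2) (k : tsd_disp Y y1 y2)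
    (s : tot_hom (L0 h) k) :
  tot_comp (tot_fun (tsd_dfun L)
              (tot_comp (tot (unit_sq h)) (tot_fun (tsd_dfun R) s)))
           (tot (counit_sq k))
  = s.
Proof.
  rewrite tot_fun_comp, <- tot_assoc, counit_sq_natural, tot_assoc.
  rewrite <- tot_dfmor, triangle_l_sq. apply tot_id_left.
Qed.

Lemma tot_counit_sq_natural x1 y1 x2 y2
    (h : tsd_disp Y x1 x2) (k : tsd_disp Y y1 y2)
    (f1 : x1 --> y1) (f2 : x2 --> y2) (u : dmor f1 f2 h k) :
  tot_comp (tot (L1 (R1 u))) (tot (counit_sq k))
  = tot_comp (tot (counit_sq h)) (tot u).
Proof. exact (tot_dntr (tsd_dnt tsd_counit) u). Qed.

(** The right triangle law and naturality of η give s = s · η · R(ε) = η · R(L(s) · ε), so the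
    transpose of s determines s. *)
Lemma transpose_inj x1 y1 x2 y2 (h : tsd_disp X x1 x2) (k : tsd_disp Y y1 y2)
    (s t : tot_hom h (R0 k)) :
  tot_comp (tot_fun (tsd_dfun L) s) (tot (counit_sq k))
  = tot_comp (tot_fun (tsd_dfun L) t) (tot (counit_sq k)) ->
  s = t.
Proof.
  intro E. rewrite <- (tot_id_right s), <- (tot_id_right t).
  rewrite <- triangle_r_sq, !tot_assoc, !unit_sq_natural, !tot_dfmor.
  rewrite <- !tot_assoc, <- !tot_fun_comp. now rewrite E.
Qed.

Lemma tot_transpose_inj x1 y1 x2 y2 (h : tsd_disp X x1 x2)
    (k : tsd_disp Y y1 y2) (f1 g1 : x1 --> R y1) (f2 g2 : x2 --> R y2)
    (u : dmor f1 f2 h (R0 k)) (v : dmor g1 g2 h (R0 k)) :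
  tot_comp (tot (L1 u)) (tot (counit_sq k))
  = tot_comp (tot (L1 v)) (tot (counit_sq k)) -> u =* v.
Proof. intro E. apply deq_tot, transpose_inj, E. Qed.

End Adjunction.

Arguments unit_sq {X Y L} r {x y} h.
Arguments counit_sq {X Y L} r {x y} h.

(** * Left adjoints in [DoubleCat] are strong *)

Section LeftAdjointStrong.
Variables (X Y : double_cat) (L : lax_double_functor X Y)
  (r : right_adjoint (B := TwoSidedDisp) (x := dc_tsd X) (y := dc_tsd Y)
         (ldf_mor L))
  (RR : lax_structure (tsd_radj r)).

Local Notation R := {| ldf_mor := tsd_radj r; ldf_lax := RR |}.

Hypotheses
  (unit_law : is_double_trans (F := dc_id1 X) (G := dc_comp1 L R) (tsd_unit r))
  (counit_law :
    is_double_trans (F := dc_comp1 R L) (G := dc_id1 Y) (tsd_counit r)).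

Local Notation L0 := (dfob (tsd_dfun L)).
Local Notation L1 := (dfmor (tsd_dfun L)).
Local Notation R0 := (dfob (tsd_dfun (tsd_radj r))).
Local Notation R1 := (dfmor (tsd_dfun (tsd_radj r))).
Local Notation η1 := (unit_at r).
Local Notation ε1 := (counit_at r).
Local Notation η := (unit_sq r).
Local Notation ε := (counit_sq r).

(** The comparison squares of [dc_id1] are identities and disappear from the law of the unit; the
    same happens in the three lemmas that follow. *)
Lemma unit_lax_id (x : X) :
  tot (η (hid (dc_str X) x))
  = tot_comp (tot_comp (tot (sqid (dc_str X) (η1 x)))
                       (tot (lax_id RR (L x))))
             (tot (R1 (lax_id (ldf_lax L) x))).
Proof.
  generalize (tot_eq (double_trans_id unit_law x)). simpl.
  unfold lax_comp_id. now tot_simp.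
Qed.

Lemma unit_lax_comp (x y z : X) (h : tsd_disp X x y) (k : tsd_disp X y z) :
  tot (η (hcomp (d := dc_str X) h k))
  = tot_comp (tot_comp (tot (sqcomp (d := dc_str X) (η h) (η k)))
                       (tot (lax_comp RR (L0 h) (L0 k))))
             (tot (R1 (lax_comp (ldf_lax L) h k))).
Proof.
  generalize (tot_eq (double_trans_comp unit_law h k)). simpl.
  unfold lax_comp_comp. now tot_simp.
Qed.

Lemma counit_lax_id (y : Y) :
  tot_comp (tot_comp (tot (lax_id (ldf_lax L) (tsd_radj r y)))
                     (tot (L1 (lax_id RR y))))
           (tot (ε (hid (dc_str Y) y)))
  = tot (sqid (dc_str Y) (ε1 y)).
Proof.
  generalize (tot_eq (double_trans_id counit_law y)). simpl.
  unfold lax_comp_id. now tot_simp.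
Qed.

Lemma counit_lax_comp (x y z : Y) (h : tsd_disp Y x y) (k : tsd_disp Y y z) :
  tot_comp (tot_comp (tot (lax_comp (ldf_lax L) (R0 h)
                                    (R0 k)))
                     (tot (L1 (lax_comp RR h k))))
           (tot (ε (hcomp (d := dc_str Y) h k)))
  = tot (sqcomp (d := dc_str Y) (ε h) (ε k)).
Proof.
  generalize (tot_eq (double_trans_comp counit_law h k)). simpl.
  unfold lax_comp_comp. now tot_simp.
Qed.

Lemma left_adjoint_over_id (x : X) :
  fmor L (η1 x) · fmor L (idm (tsd_radj r (L x))) · ε1 (L x) = idm (L x).
Proof. rewrite fmor_id, id_right. apply (triangle_l_at r). Qed.

Lemma left_adjoint_lax_id_iso (x : X) :
  is_globular_iso (lax_id (ldf_lax L) x).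
Proof.
  apply (globular_iso_of_tot
    (v := tot (L1 (sqid (dc_str X) (η1 x)) ;; L1 (lax_id RR (L x))
               ;; ε (hid (dc_str Y) (L x))))).
  (* Naturality moves the comparison of L past L(id_sq(η)); the counit law then collapses the last
     three factors to id_sq(ε), and a triangle law finishes. *)
  - rewrite !tot_dcomp, !tot_assoc.
    rewrite <- (tot_square (lax_id_natural (ldf_lax L) (η1 x))).
    rewrite (tot_comp_eq3 _ (counit_lax_id (L x))).
    rewrite tot_sqid_comp, <- tot_did, <- sqid_id. apply tot_sqid_eq.
    apply (triangle_l_at r).
  (* Naturality of ε, used backwards, brings the comparison under LR, where the unit law folds
     everything under L into η. *)
  - rewrite !tot_dcomp, <- !tot_assoc, <- (counit_sq_natural r (tot (lax_id (ldf_lax L) x))).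
    rewrite !tot_assoc, !tot_dfmor, <- !tot_fun_comp, <- !tot_dfmor.
    rewrite <- unit_lax_id. apply (triangle_l_sq r).
  - apply left_adjoint_over_id.
  - apply left_adjoint_over_id.
Qed.

(** The argument for L_id applies, with η ⊙ η in place of id_sq(η) and interchange in place of
    functoriality of [sqid]. *)
Lemma left_adjoint_lax_comp_iso (x y z : X)
    (h : tsd_disp X x y) (k : tsd_disp X y z) :
  is_globular_iso (lax_comp (ldf_lax L) h k).
Proof.
  apply (globular_iso_of_tot
    (v := tot (L1 (sqcomp (d := dc_str X) (η h) (η k))
               ;; L1 (lax_comp RR (L0 h) (L0 k))
               ;; ε (hcomp (d := dc_str Y) (L0 h) (L0 k))))).
  - rewrite !tot_dcomp, !tot_assoc.
    rewrite <- (tot_square (lax_comp_natural (ldf_lax L) (η h) (η k))).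
    rewrite (tot_comp_eq3 _ (counit_lax_comp (L0 h) (L0 k))).
    rewrite tot_sqcomp_comp, <- tot_did, <- sqcomp_id.
    apply tot_sqcomp_eq; apply (triangle_l_sq r).
  - rewrite !tot_dcomp, <- !tot_assoc, <- (counit_sq_natural r (tot (lax_comp (ldf_lax L) h k))).
    rewrite !tot_assoc, !tot_dfmor, <- !tot_fun_comp, <- !tot_dfmor.
    rewrite <- unit_lax_comp. apply (triangle_l_sq r).
  - apply left_adjoint_over_id.
  - apply left_adjoint_over_id.
Qed.

Lemma left_adjoint_strong : is_strong L.
Proof.
  split; [exact left_adjoint_lax_id_iso | exact left_adjoint_lax_comp_iso].
Qed.

End LeftAdjointStrong.

(** Each operation of [DoubleCat] acts on underlying cells, up to conversion, as the one of
    [TwoSidedDisp]; hence applying [dtr_cell] to the triangle laws is enough. *)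
Definition underlying_right_adjoint (X Y : double_cat)
    (L : lax_double_functor X Y)
    (r : right_adjoint (B := DoubleCat) (x := X) (y := Y) L) :
  right_adjoint (B := TwoSidedDisp) (x := dc_tsd X) (y := dc_tsd Y) (ldf_mor L) :=
  @Build_right_adjoint TwoSidedDisp (dc_tsd X) (dc_tsd Y) (ldf_mor L)
    (ldf_mor (radj r)) (dtr_cell (adj_unit r)) (dtr_cell (adj_counit r))
    (f_equal (@dtr_cell X Y L L) (adj_triangle_l r))
    (f_equal (@dtr_cell Y X (radj r) (radj r)) (adj_triangle_r r)).

Lemma strong_of_right_adjoint (X Y : double_cat) (L : lax_double_functor X Y)
    (r : right_adjoint (B := DoubleCat) (x := X) (y := Y) L) : is_strong L.
Proof.
  (* The preceding section expects the right adjoint as an explicit record of a 1-cell and a lax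
     structure, and records have no definitional eta. *)
  destruct r as [[R RR] [η η_law] [ε ε_law] l_law r_law].
  exact (left_adjoint_strong
    (r := underlying_right_adjoint (@Build_right_adjoint DoubleCat X Y L
            {| ldf_mor := R; ldf_lax := RR |}
            {| dtr_cell := η; dtr_law := η_law |}
            {| dtr_cell := ε; dtr_law := ε_law |} l_law r_law))
    (RR := RR) η_law ε_law).
Qed.

(** * Lifting a right adjoint of a strong functor to [DoubleCat] *)

Section LiftRightAdjoint.
Variables (X Y : double_cat) (L : lax_double_functor X Y)
  (r : right_adjoint (B := TwoSidedDisp) (x := dc_tsd X) (y := dc_tsd Y)
         (ldf_mor L))
  (L_strong : is_strong L).

Local Notation R := (tsd_radj r).
Local Notation L0 := (dfob (tsd_dfun L)).
Local Notation L1 := (dfmor (tsd_dfun L)).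
Local Notation R0 := (dfob (tsd_dfun R)).
Local Notation R1 := (dfmor (tsd_dfun R)).
Local Notation η1 := (unit_at r).
Local Notation ε1 := (counit_at r).
Local Notation η := (unit_sq r).
Local Notation ε := (counit_sq r).
Local Notation "s ⊠ t" := (sqcomp (d := ds_data (dc_str Y)) s t)
  (at level 40, left associativity).
Local Notation "s ⊞ t" := (sqcomp (d := ds_data (dc_str X)) s t)
  (at level 40, left associativity).

Lemma radj_over_id (y : Y) :
  η1 (R y) · fmor R (idm (L (R y))) · fmor R (ε1 y) = idm (R y).
Proof. rewrite fmor_id, id_right. apply triangle_r_at. Qed.

(** The adjoint transpose of the inverse of L_id followed by id_sq(ε), that is, the mate of that
    inverse; the cast uses the right triangle law. [radj_lax_comp] is formed in the same way from
    L_comp and ε ⊙ ε. *)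
Definition radj_lax_id (y : Y) :
    dmor (idm (R y)) (idm (R y)) (hid (dc_str X) (R y))
      (R0 (hid (dc_str Y) y)) :=
  dcast (radj_over_id y) (radj_over_id y)
    (η (hid (dc_str X) (R y))
     ;; R1 (globular_inv (proj1 L_strong (R y)))
     ;; R1 (sqid (dc_str Y) (ε1 y))).

Definition radj_lax_comp (x y z : Y)
    (h : tsd_disp Y x y) (k : tsd_disp Y y z) :
    dmor (idm (R x)) (idm (R z)) (hcomp (d := dc_str X) (R0 h) (R0 k))
      (R0 (hcomp (d := dc_str Y) h k)) :=
  dcast (radj_over_id x) (radj_over_id z)
    (η (hcomp (d := dc_str X) (R0 h) (R0 k))
     ;; R1 (globular_inv (proj2 L_strong _ _ _ (R0 h) (R0 k)))
     ;; R1 (ε h ⊠ ε k)).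

(** The equation that characterises R_id; later proofs use it instead of unfolding the
    definition. *)
Lemma radj_lax_id_transpose (y : Y) :
  tot_comp (tot_comp (tot (lax_id (ldf_lax L) (R y)))
                     (tot (L1 (radj_lax_id y))))
           (tot (ε (hid (dc_str Y) y)))
  = tot (sqid (dc_str Y) (ε1 y)).
Proof.
  rewrite tot_dfmor. unfold radj_lax_id.
  (* Regroups η · R(a) · R(b) as η · R(a · b), the shape that [transpose_unit] evaluates. *)
  rewrite tot_dcast, !tot_dcomp, !tot_dfmor, <- (tot_assoc _ _ (tot_fun _ _)).
  rewrite <- tot_fun_comp, <- tot_assoc, transpose_unit, tot_assoc.
  rewrite globular_inv_right. apply tot_id_left.
Qed.

Lemma radj_lax_comp_transpose (x y z : Y)
    (h : tsd_disp Y x y) (k : tsd_disp Y y z) :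
  tot_comp (tot_comp (tot (lax_comp (ldf_lax L) (R0 h) (R0 k)))
                     (tot (L1 (radj_lax_comp h k))))
           (tot (ε (hcomp (d := dc_str Y) h k)))
  = tot (ε h ⊠ ε k).
Proof.
  rewrite tot_dfmor. unfold radj_lax_comp.
  rewrite tot_dcast, !tot_dcomp, !tot_dfmor, <- (tot_assoc _ _ (tot_fun _ _)).
  rewrite <- tot_fun_comp, <- tot_assoc, transpose_unit, tot_assoc.
  rewrite globular_inv_right. apply tot_id_left.
Qed.

(** After transposition and precomposition with L_id, both sides are images under [sqid] of the two
    sides of the naturality square of ε at [v]. *)
Lemma radj_lax_id_natural (x y : Y) (v : x --> y) :
  sqid (dc_str X) (fmor R v) ;; radj_lax_id y
  =* radj_lax_id x ;; R1 (sqid (dc_str Y) v).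
Proof.
  apply (tot_transpose_inj (r := r)), (globular_iso_epi (proj1 L_strong (R x))).
  rewrite !tot_dfmor_comp, !tot_assoc.
  rewrite <- (tot_square (lax_id_natural (ldf_lax L) (fmor R v))).
  rewrite (tot_comp_eq3 _ (radj_lax_id_transpose y)).
  rewrite (tot_comp_eq2 _ (tot_counit_sq_natural r (sqid (dc_str Y) v))).
  rewrite tot_assoc, radj_lax_id_transpose, !tot_sqid_comp.
  apply tot_sqid_eq, counit_at_natural.
Qed.

Lemma radj_lax_comp_natural (x1 y1 z1 x2 y2 z2 : Y)
    (v1 : x1 --> x2) (v2 : y1 --> y2) (v3 : z1 --> z2)
    (h1 : tsd_disp Y x1 y1) (k1 : tsd_disp Y y1 z1)
    (h2 : tsd_disp Y x2 y2) (k2 : tsd_disp Y y2 z2)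
    (s1 : dmor v1 v2 h1 h2) (s2 : dmor v2 v3 k1 k2) :
  (R1 s1 ⊞ R1 s2) ;; radj_lax_comp h2 k2
  =* radj_lax_comp h1 k1 ;; R1 (s1 ⊠ s2).
Proof.
  apply (tot_transpose_inj (r := r)),
    (globular_iso_epi (proj2 L_strong _ _ _ (R0 h1) (R0 k1))).
  rewrite !tot_dfmor_comp, !tot_assoc.
  rewrite <- (tot_square (lax_comp_natural (ldf_lax L) (R1 s1) (R1 s2))).
  rewrite (tot_comp_eq3 _ (radj_lax_comp_transpose h2 k2)).
  rewrite (tot_comp_eq2 _ (tot_counit_sq_natural r (s1 ⊠ s2))).
  rewrite tot_assoc, radj_lax_comp_transpose, !tot_sqcomp_comp.
  apply tot_sqcomp_eq; apply tot_counit_sq_natural.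
Qed.

(** Prefixing (L_id ⊙ id) · L_comp to the transposes lets the unit law of L turn the left side into
    λ · ε. The right side reduces to (id_sq(ε) ⊙ ε) · λ, which equals it by naturality of λ. *)
Lemma radj_lax_lun (x y : Y) (h : tsd_disp Y x y) :
  lun (dc_str X) (R0 h)
  =* (radj_lax_id x ⊞ did (R0 h)) ;; radj_lax_comp (hid (dc_str Y) x) h
     ;; R1 (lun (dc_str Y) h).
Proof.
  apply (tot_transpose_inj (r := r)),
    (globular_iso_epi (proj2 L_strong _ _ _ (hid (dc_str X) (R x)) (R0 h))),
    (globular_iso_epi (globular_iso_sqcomp (dc_str Y) (proj1 L_strong (R x))
                         (did_is_iso (L0 (R0 h))))).
  rewrite !tot_dfmor_comp, !tot_assoc.
  generalize (tot_eq (lax_lun (ldf_lax L) (R0 h))).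
  rewrite !tot_dcomp. intros <-.
  rewrite (tot_comp_eq2 _ (tot_counit_sq_natural r (lun (dc_str Y) h))).
  (* Naturality of L_comp carries L(R_id ⊙ id) to its left, next to L_id ⊙ id, and leaves L_comp
     beside L(R_comp) · ε. *)
  rewrite (tot_comp_eq2 _ (eq_sym
    (tot_square (lax_comp_natural (ldf_lax L) (radj_lax_id x) (did (R0 h)))))).
  rewrite !tot_assoc.
  rewrite (tot_comp_eq3 _ (radj_lax_comp_transpose (hid (dc_str Y) x) h)).
  rewrite !tot_sqcomp_comp.
  rewrite <- (tot_square (lun_natural (dc_str Y) (ε h))).
  f_equal. apply tot_sqcomp_eq.
  - symmetry. rewrite !tot_dcomp. apply radj_lax_id_transpose.
  - rewrite !tot_dcomp, tot_dfmor_did, !tot_did, !tot_id_left. reflexivity.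
Qed.

Lemma radj_lax_run (x y : Y) (h : tsd_disp Y x y) :
  run (dc_str X) (R0 h)
  =* (did (R0 h) ⊞ radj_lax_id y) ;; radj_lax_comp h (hid (dc_str Y) y)
     ;; R1 (run (dc_str Y) h).
Proof.
  apply (tot_transpose_inj (r := r)),
    (globular_iso_epi (proj2 L_strong _ _ _ (R0 h) (hid (dc_str X) (R y)))),
    (globular_iso_epi (globular_iso_sqcomp (dc_str Y) (did_is_iso (L0 (R0 h)))
                         (proj1 L_strong (R y)))).
  rewrite !tot_dfmor_comp, !tot_assoc.
  generalize (tot_eq (lax_run (ldf_lax L) (R0 h))).
  rewrite !tot_dcomp. intros <-.
  rewrite (tot_comp_eq2 _ (tot_counit_sq_natural r (run (dc_str Y) h))).
  rewrite (tot_comp_eq2 _ (eq_sym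
    (tot_square (lax_comp_natural (ldf_lax L) (did (R0 h)) (radj_lax_id y))))).
  rewrite !tot_assoc.
  rewrite (tot_comp_eq3 _ (radj_lax_comp_transpose h (hid (dc_str Y) y))).
  rewrite !tot_sqcomp_comp.
  rewrite <- (tot_square (run_natural (dc_str Y) (ε h))).
  f_equal. apply tot_sqcomp_eq.
  - rewrite !tot_dcomp, tot_dfmor_did, !tot_did, !tot_id_left. reflexivity.
  - symmetry. rewrite !tot_dcomp. apply radj_lax_id_transpose.
Qed.

(** The prefix (id ⊙ L_comp) · L_comp is the one in the associativity law of L, which brings α to
    the front on the left side. Both sides then reduce to composites of α with three copies of ε. *)
Lemma radj_lax_ass (w x y z : Y)
    (h1 : tsd_disp Y w x) (h2 : tsd_disp Y x y) (h3 : tsd_disp Y y z) :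
  ass (dc_str X) (R0 h1) (R0 h2) (R0 h3)
    ;; (radj_lax_comp h1 h2 ⊞ did (R0 h3)) ;; radj_lax_comp (h1 ⊙ h2) h3
  =* (did (R0 h1) ⊞ radj_lax_comp h2 h3) ;; radj_lax_comp h1 (h2 ⊙ h3)
     ;; R1 (ass (dc_str Y) h1 h2 h3).
Proof.
  apply (tot_transpose_inj (r := r)),
    (globular_iso_epi (proj2 L_strong _ _ _ (R0 h1)
                         (hcomp (d := dc_str X) (R0 h2) (R0 h3)))),
    (globular_iso_epi (globular_iso_sqcomp (dc_str Y) (did_is_iso (L0 (R0 h1)))
                         (proj2 L_strong _ _ _ (R0 h2) (R0 h3)))).
  rewrite !tot_dfmor_comp, !tot_assoc.
  generalize (tot_eq (lax_ass (ldf_lax L) (R0 h1) (R0 h2) (R0 h3))).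
  rewrite !tot_dcomp. intros <-.
  rewrite (tot_comp_eq2 _ (tot_counit_sq_natural r (ass (dc_str Y) h1 h2 h3))).
  rewrite (tot_comp_eq2 _ (eq_sym
    (tot_square (lax_comp_natural (ldf_lax L) (radj_lax_comp h1 h2)
                                  (did (R0 h3)))))).
  rewrite (tot_comp_eq2 _ (eq_sym
    (tot_square (lax_comp_natural (ldf_lax L) (did (R0 h1))
                                  (radj_lax_comp h2 h3))))).
  rewrite !tot_assoc.
  rewrite (tot_comp_eq3 _ (radj_lax_comp_transpose (h1 ⊙ h2) h3)).
  rewrite (tot_comp_eq3 _ (radj_lax_comp_transpose h1 (h2 ⊙ h3))).
  rewrite !tot_sqcomp_comp, <- !tot_assoc, !tot_sqcomp_comp.
  (* The left side has reached α · ((ε ⊙ ε) ⊙ ε), up to the transposes still to be evaluated;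
     naturality of α relates it to this common value. *)
  transitivity (tot_comp (tot (ε h1 ⊠ (ε h2 ⊠ ε h3)))
                         (tot (ass (dc_str Y) h1 h2 h3))).
  - rewrite (tot_square (ass_natural (dc_str Y) (ε h1) (ε h2) (ε h3))).
    f_equal. apply tot_sqcomp_eq.
    + rewrite !tot_dcomp, !tot_assoc. apply radj_lax_comp_transpose.
    + rewrite !tot_dcomp, tot_dfmor_did, !tot_did, !tot_id_left. reflexivity.
  - f_equal. apply tot_sqcomp_eq.
    + rewrite !tot_dcomp, tot_dfmor_did, !tot_did, !tot_id_left. reflexivity.
    + rewrite !tot_dcomp. symmetry. apply radj_lax_comp_transpose.
Qed.

Definition radj_lax : lax_structure R :=
  @Build_lax_structure Y X R radj_lax_id (@radj_lax_comp)
    radj_lax_id_natural (@radj_lax_comp_natural)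
    radj_lax_lun radj_lax_run radj_lax_ass.

Definition double_radj : lax_double_functor Y X :=
  {| ldf_mor := R; ldf_lax := radj_lax |}.

(** After transposition and precomposition with L_id, both sides equal L_id: on the right,
    id_sq(L(η) · ε) remains in front of it and is an identity by the left triangle law. *)
Lemma unit_radj_lax_id (x : X) :
  η (hid (dc_str X) x)
  =* sqid (dc_str X) (η1 x) ;; radj_lax_id (L x) ;; R1 (lax_id (ldf_lax L) x).
Proof.
  apply (tot_transpose_inj (r := r)), (globular_iso_epi (proj1 L_strong x)).
  rewrite !tot_dfmor_comp, <- !tot_assoc.
  rewrite (tot_counit_sq_natural r (lax_id (ldf_lax L) x)), !tot_assoc.
  rewrite <- (tot_square (lax_id_natural (ldf_lax L) (η1 x))).
  rewrite (tot_comp_eq3 _ (radj_lax_id_transpose (L x))), tot_sqid_comp.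
  rewrite (tot_sqid_eq (dc_str Y) (triangle_l_at r x)), sqid_id.
  rewrite tot_did, tot_id_left, <- tot_assoc.
  rewrite (triangle_l_sq r (hid (dc_str X) x)). apply tot_id_right.
Qed.

Lemma unit_radj_lax_comp (x y z : X)
    (h : tsd_disp X x y) (k : tsd_disp X y z) :
  η (hcomp (d := dc_str X) h k)
  =* (η h ⊞ η k) ;; radj_lax_comp (L0 h) (L0 k) ;; R1 (lax_comp (ldf_lax L) h k).
Proof.
  apply (tot_transpose_inj (r := r)),
    (globular_iso_epi (proj2 L_strong _ _ _ h k)).
  rewrite !tot_dfmor_comp, <- !tot_assoc.
  rewrite (tot_counit_sq_natural r (lax_comp (ldf_lax L) h k)), !tot_assoc.
  rewrite <- (tot_square (lax_comp_natural (ldf_lax L) (η h) (η k))).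
  rewrite (tot_comp_eq3 _ (radj_lax_comp_transpose (L0 h) (L0 k))).
  rewrite tot_sqcomp_comp.
  rewrite (tot_sqcomp_eq (dc_str Y)
    (s := L1 (η h) ;; ε (L0 h)) (s' := did (L0 h))
    (t := L1 (η k) ;; ε (L0 k)) (t' := did (L0 k))
    (triangle_l_sq r h) (triangle_l_sq r k)).
  rewrite sqcomp_id, tot_did, tot_id_left, <- tot_assoc.
  rewrite (triangle_l_sq r (hcomp (d := dc_str X) h k)). apply tot_id_right.
Qed.

Lemma unit_double_law :
  is_double_trans (F := dc_id1 X) (G := dc_comp1 L double_radj) (tsd_unit r).
Proof.
  split.
  - intro x. apply deq_tot. simpl. unfold lax_comp_id. simpl.
    rewrite !tot_dcomp, tot_dcast, tot_dcomp, tot_did, tot_id_left, tot_assoc.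
    exact (tot_eq (unit_radj_lax_id x)).
  - intros x y z h k. apply deq_tot. simpl. unfold lax_comp_comp. simpl.
    rewrite !tot_dcomp, tot_dcast, tot_dcomp, tot_did, tot_id_left, tot_assoc.
    exact (tot_eq (unit_radj_lax_comp h k)).
Qed.

Lemma counit_double_law :
  is_double_trans (F := dc_comp1 double_radj L) (G := dc_id1 Y) (tsd_counit r).
Proof.
  split.
  - intro y. apply deq_tot. simpl. unfold lax_comp_id. simpl.
    rewrite !tot_dcomp, tot_dcast, tot_dcomp, tot_did, tot_id_right.
    apply radj_lax_id_transpose.
  - intros x y z h k. apply deq_tot. simpl. unfold lax_comp_comp. simpl.
    rewrite !tot_dcomp, tot_dcast, tot_dcomp, tot_did, tot_id_right.
    apply radj_lax_comp_transpose.
Qed.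

Definition double_right_adjoint :
  right_adjoint (B := DoubleCat) (x := X) (y := Y) L.
Proof.
  refine (@Build_right_adjoint DoubleCat X Y L double_radj
    (@Build_double_trans _ _ (dc_id1 X) (dc_comp1 L double_radj)
       (tsd_unit r) unit_double_law)
    (@Build_double_trans _ _ (dc_comp1 double_radj L) (dc_id1 Y)
       (tsd_counit r) counit_double_law) _ _).
  (* Equality of 2-cells is decided on underlying cells, where the triangle law is that of [r]. *)
  - abstract (apply double_trans_eq; exact (adj_triangle_l r)).
  - abstract (apply double_trans_eq; exact (adj_triangle_r r)).
Defined.

End LiftRightAdjoint.

(** * Invertible 2-cells and the characterisation of adjoint equivalences *)

Lemma inverse_double_law (X Y : double_cat) (F G : lax_double_functor X Y)
    (s : double_trans F G) (t : tsd_cell G F) :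
  tsd_vcomp s t = tsd_id2 F -> tsd_vcomp t s = tsd_id2 G ->
  is_double_trans (F := G) (G := F) t.
Proof.
  intros st ts. split.
  - intro x. apply deq_tot. rewrite !tot_dcomp.
    (* An identity is inserted before G_id and expanded as id_sq(t) · id_sq(s). The law of [s] then
       exchanges id_sq(s) · G_id for F_id · s, and s cancels against t. *)
    rewrite <- (tot_id_left (tot (lax_id (ldf_lax G) x))).
    rewrite <- tot_did, <- sqid_id.
    rewrite <- (tot_sqid_eq (dc_str Y) (v := t x · s x) (w := idm (G x))
                  (tsd_cell_eq_at ts x)).
    rewrite sqid_comp, tot_dcomp, <- !tot_assoc. f_equal. rewrite tot_assoc.
    generalize (tot_eq (double_trans_id (dtr_law s) x)).
    rewrite !tot_dcomp. intros <-. rewrite <- tot_assoc.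
    generalize (tsd_cell_eq_disp st (hid (dc_str X) x)). simpl.
    rewrite tot_dcomp, tot_did. intros ->. apply tot_id_right.
  - intros x y z h k. apply deq_tot. rewrite !tot_dcomp.
    rewrite <- (tot_id_left (tot (lax_comp (ldf_lax G) h k))).
    rewrite <- tot_did, <- sqcomp_id.
    (* Here the inserted identity is the horizontal composite of two identities, each expanded as t
       · s. *)
    rewrite <- (tot_sqcomp_eq (dc_str Y)
      (s := dntr (tsd_dnt t) h ;; dntr (tsd_dnt s) h) (s' := did _)
      (t := dntr (tsd_dnt t) k ;; dntr (tsd_dnt s) k) (t' := did _)
      (tsd_cell_eq_disp ts h) (tsd_cell_eq_disp ts k)).
    rewrite sqcomp_comp, tot_dcomp, <- !tot_assoc. f_equal. rewrite tot_assoc.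
    generalize (tot_eq (double_trans_comp (dtr_law s) h k)).
    rewrite !tot_dcomp. intros <-. rewrite <- tot_assoc.
    generalize (tsd_cell_eq_disp st (hcomp (d := dc_str X) h k)). simpl.
    rewrite tot_dcomp, tot_did. intros ->. apply tot_id_right.
Qed.

Lemma invertible_double_trans (X Y : double_cat) (F G : lax_double_functor X Y)
    (s : double_trans F G) :
  is_invertible_2cell (B := DoubleCat) (x := X) (y := Y) (f := F) (g := G) s <->
  is_invertible_2cell (B := TwoSidedDisp) (x := dc_tsd X) (y := dc_tsd Y)
    (f := ldf_mor F) (g := ldf_mor G) (dtr_cell s).
Proof.
  split.
  - intros [t [st ts]]. exists (dtr_cell t).
    exact (conj (f_equal (@dtr_cell X Y F F) st) (f_equal (@dtr_cell X Y G G) ts)).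
  - intros [t [st ts]].
    exists (@Build_double_trans X Y G F t (inverse_double_law st ts)).
    split; apply double_trans_eq; assumption.
Qed.

Theorem theorem7p3 (C1 C2 : DoubleCat) (L : cell1 C1 C2) :
  is_adjoint_equivalence (B := DoubleCat) L <->
  (is_strong L /\ is_adjoint_equivalence (B := TwoSidedDisp) (ldf_mor L)).
Proof.
  split.
  - intros [r [hη hε]]. split; [exact (strong_of_right_adjoint r)|].
    exists (underlying_right_adjoint r). split.
    + exact (proj1 (invertible_double_trans _) hη).
    + exact (proj1 (invertible_double_trans _) hε).
  (* The lifted adjunction keeps the unit and counit of [r] as underlying cells, so their
     invertibility transfers. *)
  - intros [hL [r [hη hε]]]. exists (double_right_adjoint r hL). split.
    + apply (proj2 (invertible_double_trans _)). exact hη.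
    + apply (proj2 (invertible_double_trans _)). exact hε.
Qed.
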